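(* Let $\mathcal O$ be a graded operad. A $\mathsf{D}\mathcal{O}$-algebra in graded complexes is the same as an $\mathcal{O}$-algebra in the category of unbounded bicomplexes. Precisely, for a graded complex $A$ with differential $d_v$, a $\mathsf D\mathcal O$-algebra structure on $A$ is the same thing as a horizontal differential $d_h$ making $(A,d_h,d_v)$ an unbounded bicomplex, together with an $\mathcal O$-algebra structure on this unbounded bicomplex, where $d_h$ is the action of $\epsilon$ and the $\mathcal O$-action is the restriction along $\mathcal O\cong\mathcal O\circ\mathbf{1}\to\mathsf D\mathcal O$ ($\mathbf 1$ the initial operad).
   Context: Fix a commutative ground ring $\Bbbk$. A graded complex is a bigraded $\Bbbk$-module $X=(X_{p,q})_{p,q\in\mathbb Z}$ with a differential $d\colon X_{p,q}\to X_{p,q-1}$. An unbounded bicomplex is a bigraded module with differentials $d_h\colon X_{p,q}\to X_{p-1,q}$ and $d_v\colon X_{p,q}\to X_{p,q-1}$, $d_h^2=0=d_v^2$, $d_hd_v+d_vd_h=0$. The total degree of $x\in X_{p,q}$ is $|x|=p+q$. In both cases $(X\otimes Y)_{p,q}=\bigoplus_{i+s=p,\,j+t=q}X_{i,j}\otimes Y_{s,t}$, each differential acts by $d(x\otimes y)=d(x)\otimes y+(-1)^{|x|}x\otimes d(y)$, and the symmetry is $x\otimes y\mapsto(-1)^{|x||y|}y\otimes x$. Unbounded chain complexes are included in both categories as the objects in horizontal degree $p=0$. A graded operad is an operad in unbounded chain complexes with trivial differential. $\mathcal D=\Bbbk[\epsilon]/(\epsilon^2)$, with $\epsilon$ of bidegree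 $(-1,0)$ and $d(\epsilon)=0$, is regarded as an operad in graded complexes concentrated in arity $1$. The operadic distributive law $\varphi\colon\mathcal D\circ\mathcal O\to\mathcal O\circ\mathcal D$ is given, for $\mu\in\mathcal O(r)$, by $\varphi(1;\mu)=(\mu;1,\dots,1)$ and $\varphi(\epsilon;\mu)=(-1)^{|\mu|}\sum_{i=1}^r(\mu;1,\dots,1,\epsilon,1,\dots,1)$ ($\epsilon$ in position $i$). The derived operad $\mathsf D\mathcal O=\mathcal O\circ_\varphi\mathcal D$ is the $\mathbb S$-module $\mathcal O\circ\mathcal D$ with composition $(\gamma_{\mathcal O}\circ\gamma_{\mathcal D})(\mathrm{id}\circ\varphi\circ\mathrm{id})\colon\mathcal O\circ\mathcal D\circ\mathcal O\circ\mathcal D\to\mathcal O\circ\mathcal D$, unit $(1;1)$ and trivial differential. *)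

(* Defs.v *)
From HB Require Import structures.
From mathcomp Require Import all_boot all_order all_fingroup all_algebra.

Set Implicit Arguments.
Unset Strict Implicit.
Unset Printing Implicit Defensive.

Import GRing.Theory.
Local Open Scope ring_scope.

(* Conventions.
   - A bigraded module X = (X_{p,q}) is encoded by its total module
     (+)_{p,q} X_{p,q} together with the projections onto the summands; an
     element of X_{p,q} is a vector fixed by the projection of index (p, q).
   - A degree-0 map out of a tensor product is encoded by the corresponding
     multilinear map; its compatibilities are stated on homogeneous elements,
     with the Koszul signs of the total degree. *)

Definition bideg : Type := (int * int)%type.

(* parity of the total degree *)
Definition tpar (u : bideg) : bool := odd (absz (u.1 + u.2)).

Record gmod (K : comPzRingType) := Gmod {
  gsort :> lmodType K;
  gproj : bideg -> gsort -> gsort;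
  gproj_linear : forall u, linear (gproj u);
  gproj_proj : forall u v x,
    gproj u (gproj v x) = if u == v then gproj v x else 0;
  gproj_fin : forall x, exists s : seq bideg,
    uniq s && (x == \sum_(u <- s) gproj u x)
}.

HB.instance Definition _ (K : comPzRingType) (X : gmod K) (u : bideg) :=
  GRing.isLinear.Build K X X *:%R (gproj (g := X) u) (gproj_linear u).

Definition homog (K : comPzRingType) (X : gmod K) (u : bideg) (x : X) : Prop :=
  gproj u x = x.

Definition gsupp (K : comPzRingType) (X : gmod K) (x : X) : seq bideg :=
  xchoose (gproj_fin x).

(* the linear map x |-> (-1)^(m |x|) x *)
Definition ktwist (K : comPzRingType) (X : gmod K) (m : nat) (x : X) : X :=
  \sum_(u <- gsupp x) (-1) ^+ (m * tpar u) *: gproj u x.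

Lemma gproj_out (K : comPzRingType) (X : gmod K) (x : X) (s : seq bideg)
    (u : bideg) :
  x = \sum_(v <- s) gproj v x -> u \notin s -> gproj u x = 0.
Proof.
move=> xE us; rewrite xE raddf_sum big_seq big1 // => v vs /=.
rewrite gproj_proj.
by case: eqP us => // ->; rewrite vs.
Qed.

Lemma gproj_sum (K : comPzRingType) (X : gmod K) (x : X) (s : seq bideg) :
  uniq s -> {subset gsupp x <= s} -> \sum_(v <- s) gproj v x = x.
Proof.
move=> us sub; have /andP[ux /eqP xE] := xchooseP (gproj_fin x).
rewrite -/(gsupp x) in ux xE; rewrite [RHS]xE.
rewrite (bigID (mem (gsupp x))) /= [X in _ + X]big1 ?addr0; last first.
  by move=> v; apply: gproj_out.
rewrite -big_filter; apply/perm_big/uniq_perm => //; first exact: filter_uniq.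
by move=> v; rewrite mem_filter; apply: andb_idr; apply: sub.
Qed.

Lemma ktwist_homog (K : comPzRingType) (X : gmod K) (m : nat) (u : bideg)
    (x : X) :
  homog u x -> ktwist m x = (-1) ^+ (m * tpar u) *: x.
Proof.
move=> hx; rewrite /ktwist -[in RHS](@gproj_sum _ _ x (gsupp x)) //; last first.
  by case/andP: (xchooseP (gproj_fin x)).
rewrite scaler_sumr; apply: eq_bigr => v _; rewrite -hx gproj_proj.
by case: eqP => [-> //|_]; rewrite !scaler0.
Qed.

Record gcomplex (K : comPzRingType) := Gcomplex {
  gc_gmod :> gmod K;
  dv : gc_gmod -> gc_gmod;
  dv_linear : linear dv;
  dv_homog : forall u x, homog u x -> homog (u.1, u.2 - 1) (dv x);
  dv_dv : forall x, dv (dv x) = 0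
}.

HB.instance Definition _ (K : comPzRingType) (A : gcomplex K) :=
  GRing.isLinear.Build K A A *:%R (@dv K A) (@dv_linear K A).

(* dh makes (A, dh, dv) an unbounded bicomplex *)
Record is_bicomplex (K : comPzRingType) (A : gcomplex K) (dh : A -> A) : Prop :=
  IsBicomplex {
  dh_linear : linear dh;
  dh_homog : forall u x, homog u x -> homog (u.1 - 1, u.2) (dh x);
  dh_dh : forall x, dh (dh x) = 0;
  dh_dv : forall x, dh (dv x) + dv (dh x) = 0
}.

(* The sign of x_1 ... x_r y_1 ... y_r -> x_1 y_1 ... x_r y_r is (-1) to this
   power, where x i and y i are the degrees of x_i and y_i (or their
   parities). *)
Definition shuffle_exp (r : nat) (x y : 'I_r -> nat) : nat :=
  (\sum_(i < r) \sum_(j < r | (i < j)%N) y i * x j)%N.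

(* Same for x_1 ... x_r -> x_(s 1) ... x_(s r). *)
Definition perm_exp (r : nat) (s : 'S_r) (x : 'I_r -> nat) : nat :=
  (\sum_(i < r) \sum_(j < r | (i < j)%N && (s j < s i)%N) x (s i) * x (s j))%N.

(* The position, among n = m_1 + ... + m_r inputs, of the j-th input of the
   i-th block. *)
Definition bidx (r : nat) (m : 'I_r -> nat) (n : nat)
  (e : n = (\sum_(i < r) m i)%N) (i : 'I_r) (j : 'I_(m i)) : 'I_n :=
  cast_ord (esym e) (tagnat.Rank i j).

(* The data of an operad in graded complexes. The composition has an explicit
   output arity n together with a proof that it is the sum of the input
   arities, so that no axiom has to transport along an equality of arities. *)
Record operad_data (K : comPzRingType) := OperadData {
  op_comp :> nat -> gcomplex K;
  op_unit : op_comp 1%N;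
  op_act : forall n, 'S_n -> op_comp n -> op_comp n;
  op_gamma : forall (r : nat) (m : 'I_r -> nat) (n : nat),
    n = (\sum_(i < r) m i)%N ->
    op_comp r -> (forall i, op_comp (m i)) -> op_comp n
}.

Arguments op_unit {K} P : rename.
Arguments op_act {K} P {n} s mu : rename.
Arguments op_gamma {K} P {r m n} e mu nu : rename.

(* MathComp composes permutations from left to right, so op_act is a right
   action for (s * t) x = t (s x); on an algebra it reads
   (mu . s)(a_1, ..., a_n) = +- mu(a_(s 1), ..., a_(s n)). *)
Record is_operad (K : comPzRingType) (P : operad_data K) : Prop := IsOperad {
  op_unit_homog : homog (0, 0) (op_unit P);
  op_unit_dv : dv (op_unit P) = 0;

  op_act_linear : forall n (s : 'S_n), linear (op_act P s);
  op_act_homog : forall n (s : 'S_n) u (mu : P n),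
    homog u mu -> homog u (op_act P s mu);
  op_act_dv : forall n (s : 'S_n) (mu : P n),
    dv (op_act P s mu) = op_act P s (dv mu);
  op_act1 : forall n (mu : P n), op_act P 1%g mu = mu;
  op_actM : forall n (s t : 'S_n) (mu : P n),
    op_act P (s * t)%g mu = op_act P t (op_act P s mu);

  op_gamma_linearl : forall r (m : 'I_r -> nat) n
      (e : n = (\sum_(i < r) m i)%N) (nu : forall i, P (m i)),
    linear (fun mu : P r => op_gamma P e mu nu);
  op_gamma_linearr : forall r (m : 'I_r -> nat) n
      (e : n = (\sum_(i < r) m i)%N) (mu : P r) (nu : forall i, P (m i))
      (i : 'I_r),
    linear (fun x : P (m i) => op_gamma P e mu (dfwith nu x));
  op_gamma_homog : forall r (m : 'I_r -> nat) n
      (e : n = (\sum_(i < r) m i)%N) (mu : P r) (nu : forall i, P (m i)) u v,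
    homog u mu -> (forall i, homog (v i) (nu i)) ->
    homog (u + \sum_(i < r) v i) (op_gamma P e mu nu);
  op_gamma_dv : forall r (m : 'I_r -> nat) n
      (e : n = (\sum_(i < r) m i)%N) (mu : P r) (nu : forall i, P (m i)) u v,
    homog u mu -> (forall i, homog (v i) (nu i)) ->
    dv (op_gamma P e mu nu) = op_gamma P e (dv mu) nu +
      \sum_(i < r) (-1) ^+ (tpar u + \sum_(j < r | (j < i)%N) tpar (v j))%N
        *: op_gamma P e mu (dfwith nu (dv (nu i)));

  op_gamma_unitl : forall n (e : n = (\sum_(i < 1) n)%N) (nu : P n),
    op_gamma P e (op_unit P) (fun=> nu) = nu;
  op_gamma_unitr : forall n (e : n = (\sum_(i < n) 1)%N) (mu : P n),
    op_gamma P e mu (fun=> op_unit P) = mu;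
  op_gamma_assoc : forall r (m : 'I_r -> nat) n (e : n = (\sum_(i < r) m i)%N)
      (l : 'I_n -> nat) N (e1 : N = (\sum_(p < n) l p)%N)
      (l' : 'I_r -> nat)
      (e2 : forall i, l' i = (\sum_(j < m i) l (bidx e j))%N)
      (e3 : N = (\sum_(i < r) l' i)%N)
      (mu : P r) (nu : forall i, P (m i)) (xi : forall p, P (l p)) v w,
    (forall i, homog (v i) (nu i)) -> (forall p, homog (w p) (xi p)) ->
    op_gamma P e1 (op_gamma P e mu nu) xi =
    (-1) ^+ shuffle_exp (fun i => tpar (v i))
              (fun i => \sum_(j < m i) tpar (w (bidx e j)))%N
      *: op_gamma P e3 mu
           (fun i => op_gamma P (e2 i) (nu i) (fun j => xi (bidx e j)));

  (* t is the block permutation induced by s *)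
  op_gamma_actl : forall r (m : 'I_r -> nat) n (s : 'S_r) (t : 'S_n)
      (e : n = (\sum_(i < r) m i)%N) (e' : n = (\sum_(i < r) m (s i))%N)
      (mu : P r) (nu : forall i, P (m i)) v,
    (forall i, homog (v i) (nu i)) ->
    (forall i (j : 'I_(m (s i))),
       t (bidx (m := fun i0 => m (s i0)) e' (i := i) j) = bidx e j) ->
    op_gamma P e (op_act P s mu) nu =
    (-1) ^+ perm_exp s (fun i => tpar (v i))
      *: op_act P t (op_gamma P e' mu (fun i => nu (s i)));
  (* t is the direct sum of the s i *)
  op_gamma_actr : forall r (m : 'I_r -> nat) n (s : forall i, 'S_(m i))
      (t : 'S_n) (e : n = (\sum_(i < r) m i)%N) (mu : P r)
      (nu : forall i, P (m i)),
    (forall i (j : 'I_(m i)), t (bidx e j) = bidx e (s i j)) ->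
    op_gamma P e mu (fun i => op_act P (s i) (nu i)) =
    op_act P t (op_gamma P e mu nu)
}.

(* A graded operad, as an operad in graded complexes: chain complexes are the
   graded complexes concentrated in horizontal degree 0. *)
Record graded_operad (K : comPzRingType) := GradedOperad {
  go_data :> operad_data K;
  go_operad : is_operad go_data;
  go_hdeg : forall n (u : bideg) (mu : go_data n),
    homog u mu -> u.1 != 0 -> mu = 0;
  go_dv : forall n (mu : go_data n), dv mu = 0
}.

(* Multilinear maps P(n) x A^n -> A, for all n. *)
Definition op_action (K : comPzRingType) (P : operad_data K) (A : gmod K) :=
  forall n : nat, P n -> ('I_n -> A) -> A.

(* Algebras in bigraded modules: everything but the differentials. *)
Record is_algebra (K : comPzRingType) (P : operad_data K) (A : gmod K)
  (act : op_action P A) : Prop := IsAlgebra {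
  alg_linearl : forall n (a : 'I_n -> A), linear (fun mu => act n mu a);
  alg_linearr : forall n (mu : P n) (a : 'I_n -> A) (i : 'I_n),
    linear (fun x : A => act n mu (@dfwith _ (fun=> gsort A) a i x));
  alg_homog : forall n (mu : P n) (a : 'I_n -> A) u v,
    homog u mu -> (forall i, homog (v i) (a i)) ->
    homog (u + \sum_(i < n) v i) (act n mu a);
  alg_unit : forall a : 'I_1 -> A, act 1%N (op_unit P) a = a ord0;
  alg_assoc : forall r (m : 'I_r -> nat) n (e : n = (\sum_(i < r) m i)%N)
      (mu : P r) (nu : forall i, P (m i)) (a : 'I_n -> A) v w,
    (forall i, homog (v i) (nu i)) -> (forall p, homog (w p) (a p)) ->
    act n (op_gamma P e mu nu) a =
    (-1) ^+ shuffle_exp (fun i => tpar (v i))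
              (fun i => \sum_(j < m i) tpar (w (bidx e j)))%N
      *: act r mu (fun i => act (m i) (nu i) (fun j => a (bidx e j)));
  alg_equivariant : forall n (s : 'S_n) (mu : P n) (a : 'I_n -> A) w,
    (forall p, homog (w p) (a p)) ->
    act n (op_act P s mu) a =
    (-1) ^+ perm_exp s (fun p => tpar (w p)) *: act n mu (fun p => a (s p))
}.

(* The structure maps P(n) (x) A^(x)n -> A commute with the differentials dP
   and dA. *)
Definition act_chain (K : comPzRingType) (P : operad_data K) (A : gmod K)
  (act : op_action P A) (dP : forall n, P n -> P n) (dA : A -> A) : Prop :=
  forall n (mu : P n) (a : 'I_n -> A) u v,
    homog u mu -> (forall i, homog (v i) (a i)) ->
    dA (act n mu a) = act n (dP n mu) a +
      \sum_(i < n) (-1) ^+ (tpar u + \sum_(j < n | (j < i)%N) tpar (v j))%N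
        *: act n mu (@dfwith _ (fun=> gsort A) a i (dA (a i))).

Definition is_gc_algebra (K : comPzRingType) (P : operad_data K)
  (A : gcomplex K) (act : op_action P A) : Prop :=
  is_algebra act /\ act_chain act (fun n => @dv K (P n)) (@dv K A).

(* P is an operad in chain complexes: its horizontal differential is 0. *)
Definition is_bicomplex_algebra (K : comPzRingType) (P : operad_data K)
  (A : gcomplex K) (dh : A -> A) (act : op_action P A) : Prop :=
  [/\ is_algebra act,
      act_chain act (fun n (_ : P n) => 0) dh
    & act_chain act (fun n => @dv K (P n)) (@dv K A)].

(* D = K[eps]/(eps^2) has basis eps^b with b : bool, so D^(x)n has basis the
   eps^(b_1) (x) ... (x) eps^(b_n) with b : ebasis n. *)
Definition ebasis (n : nat) : finType := {ffun 'I_n -> bool}.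

Definition ebasis0 (n : nat) : ebasis n := [ffun=> false].
Definition ebasis1 (n : nat) (i : 'I_n) : ebasis n := [ffun j => j == i].
Definition edeg (n : nat) (b : ebasis n) : nat := (\sum_(i < n) b i)%N.
Definition eblock (r : nat) (m : 'I_r -> nat) (n : nat)
  (e : n = (\sum_(i < r) m i)%N) (b : ebasis n) (i : 'I_r) : ebasis (m i) :=
  [ffun j => b (bidx e (i := i) j)].

Section Derived.
Variables (K : comPzRingType) (O : operad_data K).

(* As D is concentrated in arity 1, (O o D)(n) = O(n) (x) D^(x)n: an element x
   stands for the sum over b of (x b; eps^(b_1), ..., eps^(b_n)). *)
Definition OD (n : nat) : lmodType K := {ffun ebasis n -> O n}.

Definition od_pure n (mu : O n) (b : ebasis n) : OD n :=
  [ffun c => if c == b then mu else 0].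

(* eps has bidegree (-1, 0) *)
Definition od_proj n (u : bideg) (x : OD n) : OD n :=
  [ffun b => gproj (u.1 + (edeg b)%:Z, u.2) (x b)].

Lemma od_proj_linear n (u : bideg) : linear (@od_proj n u).
Proof.
by move=> c x y; apply/ffunP => b; rewrite !ffunE gproj_linear.
Qed.

Lemma od_proj_proj n (u v : bideg) (x : OD n) :
  od_proj u (od_proj v x) = if u == v then od_proj v x else 0.
Proof.
apply/ffunP => b; rewrite !ffunE gproj_proj !xpair_eqE (inj_eq (addIr _)).
by rewrite -pair_eqE /pair_eq /=; case: ifP; rewrite ffunE.
Qed.

Lemma od_proj_fin n (x : OD n) : exists s : seq bideg,
  uniq s && (x == \sum_(u <- s) od_proj u x).
Proof.
pose s := undup (flatten
  [seq [seq (v.1 - (edeg b)%:Z, v.2) | v <- gsupp (x b)] | b : ebasis n]).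
exists s; rewrite undup_uniq; apply/eqP/ffunP => b; rewrite sum_ffunE.
pose f (u : bideg) : bideg := (u.1 + (edeg b)%:Z, u.2).
transitivity (\sum_(u <- map f s) gproj u (x b)); last first.
  by rewrite big_map; apply: eq_bigr => u _; rewrite ffunE.
rewrite gproj_sum // => [|v vb].
  rewrite map_inj_uniq ?undup_uniq // => -[p q] [p' q'] [/addIr -> ->] //.
apply/mapP; exists (v.1 - (edeg b)%:Z, v.2);
  last by case: v {vb} => p q; rewrite /f /= subrK.
rewrite mem_undup; apply/flattenP.
exists [seq (v.1 - (edeg b)%:Z, v.2) | v <- gsupp (x b)].
  by apply/mapP; exists b => //; rewrite mem_enum.
by apply/mapP; exists v.
Qed.

Definition od_gmod (n : nat) : gmod K :=
  Gmod (@od_proj_linear n) (@od_proj_proj n) (@od_proj_fin n).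

Definition od_dv (n : nat) (x : od_gmod n) : od_gmod n := 0.

Lemma od_dv_linear n : linear (@od_dv n).
Proof. by move=> c x y; rewrite /od_dv scaler0 addr0. Qed.

Lemma od_dv_homog n u (x : od_gmod n) :
  homog u x -> homog (u.1, u.2 - 1) (od_dv x).
Proof.
by move=> _; have := @od_proj_linear n (u.1, u.2 - 1) (-1) 0 0;
  rewrite scaler0 addr0 scaleN1r addNr.
Qed.

Definition od_gcomplex (n : nat) : gcomplex K :=
  Gcomplex (@od_dv_linear n) (@od_dv_homog n) (fun=> erefl).

(* (mu; eps^c) . s = +- (mu . s; eps^b) where b (s i) = c i *)
Definition od_act n (s : 'S_n) (x : OD n) : OD n :=
  [ffun b : ebasis n => (-1) ^+ perm_exp s (fun i => nat_of_bool (b i))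
     *: op_act O s (x [ffun i => b (s i)])].

(* the distributive law: phi b mu = varphi(eps^b; mu) *)
Definition phi (r : nat) (b : bool) (mu : O r) : OD r :=
  if b then \sum_(i < r) od_pure (ktwist 1 mu) (ebasis1 i)
  else od_pure mu (ebasis0 r).

(* (mu; eps^(h_1) eps^(f_1), ..., eps^(h_n) eps^(f_n)), using eps^2 = 0 *)
Definition od_mul n (mu : O n) (h f : ebasis n) : OD n :=
  if [exists p, h p && f p] then 0
  else od_pure mu [ffun p => h p || f p].

(* The composite (gamma_O o gamma_D)(id o varphi o id) on
     ((x a; eps^a); (y_1 f_1; eps^(f_1)), ..., (y_r f_r; eps^(f_r))),
   where f_i = eblock e f i. The Koszul sign of each reordering is
     y_1 f_1 ... y_r f_r -> y_1 ... y_r f_1 ... f_r :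
       y_i passes f_j for j < i,
     a_1 ... a_r y_1 ... y_r -> a_1 y_1 ... a_r y_r :
       y_i passes a_j for i < j,
     (after varphi, with terms (y_i; eps^(h_i)))
     y_1 h_1 ... y_r h_r -> y_1 ... y_r h_1 ... h_r :
       y_i passes h_j for j < i,
     h f -> interleaving of the inputs h_p and f_p, for p < n.
   The first three are the factors (-1)^(c i * |y_i|), applied by ktwist. *)
Definition od_gamma (r : nat) (m : 'I_r -> nat) (n : nat)
  (e : n = (\sum_(i < r) m i)%N) (x : OD r) (y : forall i, OD (m i)) : OD n :=
  \sum_(a : ebasis r) \sum_(f : ebasis n) \sum_(h : ebasis n)
    let c i := (\sum_(j < r | j < i) edeg (eblock e f j)
                + \sum_(j < r | i < j) a j
                + \sum_(j < r | j < i) edeg (eblock e h j))%N in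
    (-1) ^+ shuffle_exp (fun p => nat_of_bool (h p))
                        (fun p => nat_of_bool (f p))
      *: od_mul (op_gamma O e (x a) (fun i =>
                  ktwist (c i) (phi (a i) (y i (eblock e f i)) (eblock e h i))))
                h f.

Definition derived : operad_data K :=
  @OperadData K od_gcomplex (od_pure (op_unit O) (ebasis0 1)) od_act od_gamma.

Definition derived_eps : derived 1%N := od_pure (op_unit O) (ebasis1 ord0).

(* O = O o 1 -> O o D *)
Definition derived_incl (n : nat) (mu : O n) : derived n :=
  od_pure mu (ebasis0 n).

End Derived.

Definition eps_action (K : comPzRingType) (O : operad_data K) (A : gmod K)
  (act : op_action (derived O) A) (a : A) : A :=
  act 1%N (derived_eps O) (fun=> a).

Definition restr_action (K : comPzRingType) (O : operad_data K) (A : gmod K)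
  (act : op_action (derived O) A) : op_action O A :=
  fun n mu a => act n (derived_incl mu) a.

(* Main.v *)
From Stdlib Require Import FunctionalExtensionality.
Require Import Defs.
From mathcomp Require Import all_boot all_order all_fingroup all_algebra.
From mathcomp Require Import zify.

(* An element (mu; eps^(b_1), ..., eps^(b_n)) of DO is, up to sign, the composite
   of mu with the eps^(b_i), so in a DO-algebra it must act by
     a_1, ..., a_n |-> +- mu (dh^(b_1) a_1, ..., dh^(b_n) a_n),
   which gives uniqueness. Conversely this formula defines an action: pushing dh
   through the structure maps of an O-algebra in bicomplexes is the distributive
   law phi, and dh^2 = 0 is eps^2 = 0. Associativity then reduces to comparing
   Koszul signs, block by block. *)

Set Implicit Arguments.
Unset Strict Implicit.
Unset Printing Implicit Defensive.

Import Order.TTheory GRing.Theory.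
Local Open Scope ring_scope.

(** The axioms that carry signs are stated on homogeneous arguments, while the action has to be
    defined, and shown unique, on all arguments. So the sign of the formula is built in through
    [ktwist], which is linear and makes sense on every input, and identities checked on homogeneous
    inputs are extended by multilinearity.

    In the associativity law both sides become sums of the same terms over triples ([al], [f], [h]):
    the eps carried by the outer operation, those carried by the inner operations, and those
    produced by [phi]. Acting in two stages yields a separate pair of sums for each block of inputs;
    these have to be recombined into one [f] and one [h] on all n inputs. The signs are compared
    only when block i of [h] contains exactly [al i] copies of eps; otherwise [phi] has coefficient
    zero there and both terms vanish. *)

(** * Linear and multilinear maps *)

Lemma fext (I : Type) (V : I -> Type) (f g : forall i, V i) :
  (forall i, f i = g i) -> f = g.
Proof. exact: functional_extensionality_dep. Qed.

Section Linear.
Variables (K : pzRingType) (V W : lmodType K) (f : V -> W).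
Hypothesis flin : linear f.

Lemma lin0 : f 0 = 0.
Proof. by have := flin (-1) 0 0; rewrite scaler0 addr0 scaleN1r addNr. Qed.

Lemma linD x y : f (x + y) = f x + f y.
Proof. by have := flin 1 x y; rewrite !scale1r. Qed.

Lemma linZ c x : f (c *: x) = c *: f x.
Proof. by have := flin c x 0; rewrite lin0 !addr0. Qed.

Lemma lin_sum (I : Type) (s : seq I) (P : pred I) (F : I -> V) :
  f (\sum_(i <- s | P i) F i) = \sum_(i <- s | P i) f (F i).
Proof. exact: (big_morph f linD lin0). Qed.

End Linear.

Section Dfwith.
Variables (I : eqType) (V W : I -> Type).

Lemma dfwith_same (a : forall i, V i) i : dfwith a (a i) = a.
Proof. by apply: fext => j; case: dfwithP. Qed.

Lemma dfwith_map (F : forall i, V i -> W i) (a : forall i, V i) i (x : V i) :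
  (fun j => F j (dfwith a x j)) = dfwith (fun j => F j (a j)) (F i x).
Proof.
apply: fext => j; case: dfwithP => [|k ik]; first by rewrite dfwith_in.
by rewrite dfwith_out.
Qed.

End Dfwith.

Section Multilinear.
Variables (K : comPzRingType) (I : finType) (V : I -> lmodType K).
Variable W : lmodType K.

Definition multilinear (F : (forall i, V i) -> W) : Prop :=
  forall a i, linear (fun x => F (dfwith a (i := i) x)).

End Multilinear.

Section MultilinearTheory.
Variables (K : comPzRingType) (I : finType) (V : I -> lmodType K).
Variable W : lmodType K.

Lemma multilin0 (F : (forall i, V i) -> W) a i : multilinear F -> a i = 0 -> F a = 0.
Proof. by move=> Flin ai; rewrite -(dfwith_same a i) ai (lin0 (Flin a i)). Qed.

(** One coordinate is decomposed at a time: the list [s] in [H] holds the coordinates that may still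
    be sums rather than elements of [P]. *)
Lemma multilin_ext (P : forall i, V i -> Prop) (F G : (forall i, V i) -> W) a :
    multilinear F -> multilinear G ->
    (forall i, exists s : seq (V i),
       a i = \sum_(x <- s) x /\ forall x, x \in s -> P i x) ->
    (forall b, (forall i, P i (b i)) -> F b = G b) ->
  F a = G a.
Proof.
move=> Flin Glin aP FG.
pose gen i (v : V i) :=
  exists s : seq (V i), v = \sum_(x <- s) x /\ forall x, x \in s -> P i x.
suff H (s : seq I) b :
    (forall i, gen i (b i)) -> (forall i, i \notin s -> P i (b i)) -> F b = G b.
  by apply: (H (enum I)) => // i; rewrite mem_enum.
elim: s b => [|k s IH] b bgen bP; first by apply: FG => i; apply: bP.
have [l [bl lP]] := bgen k.
rewrite -(dfwith_same b k) bl.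
rewrite (lin_sum (Flin b k)) (lin_sum (Glin b k)) big_seq [RHS]big_seq.
apply: eq_bigr => x xl; have Px := lP x xl; apply: IH => i.
  case: dfwithP => //; exists [:: x]; rewrite big_seq1.
  by split=> // y; rewrite inE => /eqP->.
case: dfwithP => // j kj js; apply: bP.
by rewrite inE negb_or eq_sym kj.
Qed.

Lemma multilinZ (F : (forall i, V i) -> W) (k : I -> K) a :
  multilinear F -> F (fun i => k i *: a i) = (\prod_i k i) *: F a.
Proof.
move=> Flin.
suff H (s : seq I) : uniq s ->
    F (fun i => (if i \in s then k i else 1) *: a i) = (\prod_(i <- s) k i) *: F a.
  rewrite -big_enum -H ?enum_uniq //; congr F; apply: fext => i.
  by rewrite mem_enum.
elim: s => [_|j s IH /= /andP[js us]].
  by rewrite big_nil scale1r; congr F; apply: fext => i; rewrite scale1r.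
rewrite big_cons -scalerA -IH // -[LHS](congr1 F (dfwith_same _ j)).
rewrite mem_head (linZ (Flin _ j)); congr (_ *: F _); apply: fext => i.
case: dfwithP => [|l jl]; first by rewrite (negPf js) scale1r.
by rewrite inE eq_sym (negPf jl).
Qed.

Lemma multilinear_sum (J : finType) (F : J -> (forall i, V i) -> W) :
  (forall j, multilinear (F j)) -> multilinear (fun a => \sum_j F j a).
Proof.
move=> Flin a i c x y; rewrite scaler_sumr -big_split.
by apply: eq_bigr => j _; apply: Flin.
Qed.

Lemma multilinear_comp (U : I -> lmodType K) (L : forall i, U i -> V i)
    (F : (forall i, V i) -> W) :
  (forall i, linear (L i)) -> multilinear F ->
  @multilinear _ _ U W (fun a => F (fun i => L i (a i))).
Proof.
move=> Llin Flin a i c x y.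
by rewrite !(dfwith_map (fun j => L j)) Llin (Flin _ i).
Qed.

End MultilinearTheory.

(** The type [B] stands for the product of the [T i]. With [eblock] and [ejoin] as [pr] and [jn], a
    product of sums over the blocks becomes directly a sum over [ebasis n]. *)
Lemma multilin_distr (K : comPzRingType) (I : finType) (V : I -> lmodType K)
    (W : lmodType K) (F : (forall i, V i) -> W) (T : I -> finType) (B : finType)
    (pr : B -> forall i, T i) (jn : (forall i, T i) -> B)
    (Z : forall i, T i -> V i) :
    cancel pr jn -> (forall g i, pr (jn g) i = g i) -> multilinear F ->
  F (fun i => \sum_t Z i t) = \sum_b F (fun i => Z i (pr b i)).
Proof.
move=> prK jnK Flin.
pose V' i : lmodType K := {ffun T i -> V i}.
(* On families c where each c i is supported at one point, both sides agree
   trivially; such families span. *)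
pose P i (c : V' i) := exists t, forall u, u != t -> c u = 0.
pose F1 (c : forall i, V' i) := F (fun i => \sum_t c i t).
pose F2 (c : forall i, V' i) := \sum_b F (fun i => c i (pr b i)).
suff /= : F1 (fun i => [ffun t => Z i t]) = F2 (fun i => [ffun t => Z i t]).
  rewrite /F1 /F2 => E; transitivity (F (fun i => \sum_t [ffun t => Z i t] t)).
    by congr F; apply: fext => i; apply: eq_bigr => t _; rewrite ffunE.
  by rewrite E; apply: eq_bigr => b _; congr F; apply: fext => i; rewrite ffunE.
apply: (@multilin_ext _ _ V' W P).
- apply: (multilinear_comp (L := fun i (c : V' i) => \sum_t c t)) => // i k x y.
  by rewrite scaler_sumr -big_split; apply: eq_bigr => t _; rewrite !ffunE.
- apply: multilinear_sum => b.
  apply: (multilinear_comp (L := fun i (c : V' i) => c (pr b i))) => // i k x y.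
  by rewrite !ffunE.
- move=> i; exists [seq ([ffun u => if u == t then Z i t else 0] : V' i) | t : T i].
  split.
    apply/ffunP => u; rewrite ffunE big_image sum_ffunE (bigD1 u) //= big1.
      by rewrite addr0 ffunE eqxx.
    by move=> t tu; rewrite ffunE eq_sym (negPf tu).
  by move=> _ /imageP[t _ ->]; exists t => u ut; rewrite ffunE (negPf ut).
- move=> c /fin_all_exists[g gP].
  (* Every index other than [jn g] leaves the support in some coordinate, where the family is 0. *)
  rewrite /F2 (bigD1 (jn g)) //= big1 ?addr0 => [|b bg].
    congr F; apply: fext => i; rewrite jnK (bigD1 (g i)) //= big1 ?addr0 //.
    exact: gP.
  have /existsP[i bi] : [exists i, pr b i != g i].
    rewrite -negb_forall; apply: contra bg => /forallP bg.
    by rewrite -(prK b); apply/eqP; congr jn; apply: fext => i; apply/eqP.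
  by apply: (multilin0 (i := i)) => //; apply: gP.
Qed.

(** * Parities of Koszul exponents *)

Lemma sign_parity (R : pzRingType) (m n : nat) :
  odd m = odd n -> (-1) ^+ m = (-1) ^+ n :> R.
Proof. by move=> mn; rewrite -signr_odd mn signr_odd. Qed.

Lemma odd_sum (I : finType) (P : pred I) (F G : I -> nat) :
  (forall i, P i -> odd (F i) = odd (G i)) ->
  odd (\sum_(i | P i) F i) = odd (\sum_(i | P i) G i).
Proof.
move=> FG; elim/big_ind2: _ => // m m' k k' mm kk.
by rewrite !oddD mm kk.
Qed.

Lemma odd_shuffle r (x x' y y' : 'I_r -> nat) :
  (forall i, odd (x i) = odd (x' i)) -> (forall i, odd (y i) = odd (y' i)) ->
  odd (shuffle_exp x y) = odd (shuffle_exp x' y').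
Proof.
move=> xx yy; apply: odd_sum => i _; apply: odd_sum => j _.
by rewrite !oddM xx yy.
Qed.

Lemma odd_perm_exp r (s : 'S_r) (x x' : 'I_r -> nat) :
  (forall i, odd (x i) = odd (x' i)) ->
  odd (perm_exp s x) = odd (perm_exp s x').
Proof.
move=> xx; apply: odd_sum => i _; apply: odd_sum => j _.
by rewrite !oddM !xx.
Qed.

Lemma shuffle_expDl r (x x' y : 'I_r -> nat) :
  (shuffle_exp (fun i => x i + x' i) y = shuffle_exp x y + shuffle_exp x' y)%N.
Proof.
rewrite -big_split; apply: eq_bigr => i _; rewrite -big_split.
by apply: eq_bigr => j _; rewrite mulnDr.
Qed.

Lemma shuffle_expDr r (x y y' : 'I_r -> nat) :
  (shuffle_exp x (fun i => y i + y' i) = shuffle_exp x y + shuffle_exp x y')%N.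
Proof.
rewrite -big_split; apply: eq_bigr => i _; rewrite -big_split.
by apply: eq_bigr => j _; rewrite mulnDl.
Qed.

Lemma shuffle_exp0l r (x y : 'I_r -> nat) : (forall i, x i = 0%N) ->
  shuffle_exp x y = 0%N.
Proof. by move=> x0; rewrite /shuffle_exp; do 2!(apply: big1 => ? _); rewrite x0 muln0. Qed.

Lemma shuffle_exp0r r (x y : 'I_r -> nat) : (forall i, y i = 0%N) ->
  shuffle_exp x y = 0%N.
Proof. by move=> y0; rewrite /shuffle_exp; do 2!(apply: big1 => ? _); rewrite y0. Qed.

Lemma shuffle_exp1 (x y : 'I_1 -> nat) : shuffle_exp x y = 0%N.
Proof.
by rewrite /shuffle_exp big_ord1 big_pred0 // => i; rewrite (ord1 i).
Qed.

Lemma shuffle_expE r (x y : 'I_r -> nat) :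
  shuffle_exp x y = (\sum_i y i * \sum_(j < r | (i < j)%N) x j)%N.
Proof. by apply: eq_bigr => i _; rewrite big_distrr. Qed.

Lemma shuffle_expE' r (x y : 'I_r -> nat) :
  shuffle_exp x y = (\sum_j x j * \sum_(i < r | (i < j)%N) y i)%N.
Proof.
rewrite /shuffle_exp (exchange_big_dep predT) //=.
by apply: eq_bigr => j _; rewrite big_distrr; apply: eq_bigr => i _; rewrite mulnC.
Qed.

(** * Inputs grouped into blocks *)

Section Blocks.
Variables (r : nat) (m : 'I_r -> nat) (n : nat) (e : n = (\sum_(i < r) m i)%N).

Lemma bidx_surj (p : 'I_n) : {i : 'I_r & {j : 'I_(m i) | bidx e j = p}}.
Proof.
pose q := cast_ord e p; exists (tagnat.sig1 q), (tagnat.sig2 q).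
by rewrite /bidx tagnat.sig2K cast_ordK.
Qed.

Lemma bidx_lt i i' (j : 'I_(m i)) (j' : 'I_(m i')) : i != i' ->
  (bidx e j < bidx e j')%N = (i < i')%N.
Proof.
move=> ii'; have -> : (bidx e j < bidx e j')%N =
    (Tagged (fun i => 'I_(m i)) j < Tagged (fun i => 'I_(m i)) j')%O.
  exact: (tagnat.lt_rank (Tagged (fun i => 'I_(m i)) j) (Tagged _ j')).
rewrite ltEsig /= !leEord.
by case: (ltngtP i i') => //= E; case/eqP: ii'; apply: val_inj.
Qed.

Lemma bidx_lt_in i (j j' : 'I_(m i)) : (bidx e j < bidx e j')%N = (j < j')%N.
Proof. exact: (@tagnat.lt_Rank _ m i j j'). Qed.

Lemma bidx_sum (R : nmodType) (F : 'I_n -> R) :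
  \sum_p F p = \sum_i \sum_(j < m i) F (bidx e j).
Proof.
have bb : {on [pred _ | true], bijective (cast_ord (esym e))}.
  by apply/onW_bij; exists (cast_ord e) => i; rewrite ?cast_ordK ?cast_ordKV.
rewrite (reindex _ bb) (reindex _ (@tagnat.rank_bij_on _ m)) /=.
rewrite sig_big_dep /=.
by apply: eq_big => // -[].
Qed.

Lemma bidx_sumn (F : 'I_n -> nat) :
  (\sum_p F p = \sum_i \sum_(j < m i) F (bidx e j))%N.
Proof. exact: bidx_sum. Qed.

Lemma eblockE (b : ebasis n) i j : eblock e b i j = b (bidx e j).
Proof. by rewrite ffunE. Qed.

(** Inverse of [eblock]; it can be defined by a match because [bidx_surj] lives in [Type]. *)
Definition ejoin (g : forall i, ebasis (m i)) : ebasis n :=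
  [ffun p => let: existT i (exist j _) := bidx_surj p in g i j].

Lemma ejoinE g i (j : 'I_(m i)) : ejoin g (bidx e j) = g i j.
Proof.
rewrite ffunE; case: bidx_surj => i' [j' /cast_ord_inj/tagnat.rank_inj E].
exact: (congr1 (fun u => g (tag u) (tagged u)) E).
Qed.

Lemma eblockK (b : ebasis n) : ejoin (eblock e b) = b.
Proof.
by apply/ffunP => p; have [i [j <-]] := bidx_surj p; rewrite ejoinE eblockE.
Qed.

Lemma ejoinK g i : eblock e (ejoin g) i = g i.
Proof. by apply/ffunP => j; rewrite eblockE ejoinE. Qed.

(** A pair of inputs lies either in one block or in two; in two different blocks its order is that
    of the blocks, so these pairs add up to the shuffle of the block totals. *)
Lemma shuffle_exp_block (x y : 'I_n -> nat) :
  shuffle_exp x y =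
    (\sum_i shuffle_exp (fun j => x (bidx e (i := i) j)) (fun j => y (bidx e j)) +
     shuffle_exp (fun i => \sum_(j < m i) x (bidx e j))
                 (fun i => \sum_(j < m i) y (bidx e j)))%N.
Proof.
rewrite {1}/shuffle_exp bidx_sumn [X in (_ + X)%N]/shuffle_exp -big_split /=.
apply: eq_bigr => i _.
have -> : (\sum_(i' < r | (i < i')%N)
             (\sum_(j < m i) y (bidx e j)) * (\sum_(j < m i') x (bidx e j)) =
           \sum_(j < m i) \sum_(i' < r | (i < i')%N)
             \sum_(j' < m i') y (bidx e j) * x (bidx e j'))%N.
  rewrite exchange_big; apply: eq_bigr => i' _.
  rewrite big_distrl; apply: eq_bigr => j _ /=; exact: big_distrr.
rewrite -big_split; apply: eq_bigr => j _ /=.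
rewrite big_mkcond bidx_sumn (bigD1 i) //= [in RHS]big_mkcond; congr (_ + _)%N.
  by apply: eq_bigr => j' _; rewrite bidx_lt_in.
rewrite [in RHS]big_mkcond [in RHS](bigD1 i) //= ltnn add0n; apply: eq_bigr => i' ii'.
case: ifP => i'lt.
  by apply: eq_bigr => j' _; rewrite bidx_lt 1?eq_sym // i'lt.
by apply: big1 => j' _; rewrite bidx_lt 1?eq_sym // i'lt.
Qed.

End Blocks.

Lemma bidx_ord1 n (e : n = (\sum_(i < 1) n)%N) (i : 'I_1) (j : 'I_n) :
  bidx (m := fun=> n) e (i := i) j = j.
Proof.
apply: val_inj; transitivity (nat_of_ord (@tagnat.Rank 1 (fun=> n) i j)) => //.
rewrite tagnat.RankEsum.
by rewrite big1 ?add0n // => k; rewrite !ord1.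
Qed.

Lemma bidx_const1 n (e : n = (\sum_(i < n) 1)%N) (i : 'I_n) (j : 'I_1) :
  bidx (m := fun=> 1%N) e (i := i) j = i.
Proof.
apply: val_inj; transitivity (nat_of_ord (@tagnat.Rank n (fun=> 1%N) i j)) => //.
rewrite tagnat.RankEsum (ord1 j) addn0.
rewrite -[RHS]card_ord -sum1_card; rewrite (big_ord_narrow (ltnW (ltn_ord i))).
by [].
Qed.

Lemma sum_ltn_gtn n (i : 'I_n) (F : 'I_n -> nat) :
  (\sum_j F j =
   \sum_(j < n | (j < i)%N) F j + F i + \sum_(j < n | (i < j)%N) F j)%N.
Proof.
rewrite (bigID (fun j : 'I_n => (j < i)%N)) /= -addnA; congr (_ + _)%N.
rewrite (bigD1 i) ?ltnn //=; congr (_ + _)%N; apply: eq_bigl => j.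
by rewrite -leqNgt [RHS]ltn_neqAle andbC eq_sym.
Qed.

(** Attaching the eps to the inputs and then permuting costs the same sign as permuting both and
    then attaching. [X] and [Y] are the two kinds of mixed terms at inversions of [s], and [C] the
    mixed terms at the other pairs. Both sides are [perm_exp s w + perm_exp s b + C + Y], up to a
    term [X] that occurs twice on the left. *)
Lemma perm_exp_shuffle n (s : 'S_n) (b w : 'I_n -> nat) :
  odd (perm_exp s (fun i => w i + b i) + shuffle_exp b w)%N =
  odd (perm_exp s w + perm_exp s b +
       shuffle_exp (fun i => b (s i)) (fun i => w (s i)))%N.
Proof.
pose X := (\sum_(i < n) \sum_(j < n | (i < j)%N && (s j < s i)%N) w (s j) * b (s i))%N.
pose Y := (\sum_(i < n) \sum_(j < n | (i < j)%N && (s j < s i)%N) w (s i) * b (s j))%N.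
pose C := (\sum_(i < n) \sum_(j < n | (i < j)%N && (s i < s j)%N) w (s i) * b (s j))%N.
have neq (i j : 'I_n) : (i < j)%N -> (s i == s j :> nat) = false.
  move=> ij; apply/negbTE; rewrite val_eqE (inj_eq perm_inj) neq_ltn.
  by rewrite ij.
have -> : perm_exp s (fun i => w i + b i)%N =
    (perm_exp s w + perm_exp s b + X + Y)%N.
  rewrite -!big_split; apply: eq_bigr => i _; rewrite -!big_split.
  by apply: eq_bigr => j _ /=; lia.
have -> : shuffle_exp b w = (C + X)%N.
  transitivity (\sum_(i < n) \sum_(j < n | (s i < s j)%N) w (s i) * b (s j))%N.
    rewrite /shuffle_exp (reindex_inj (@perm_inj _ s)); apply: eq_bigr => i _.
    by rewrite (reindex_inj (@perm_inj _ s)).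
  rewrite /C /X [in X in (_ + X)%N](exchange_big_dep predT) //= -big_split; apply: eq_bigr => i _.
  rewrite (bigID (fun j : 'I_n => (i < j)%N)) /=; congr (_ + _)%N.
    by apply: eq_bigl => j; rewrite andbC.
  apply: eq_bigl => j; rewrite andbC; apply: andb_id2r => ij.
  by rewrite -leqNgt leq_eqVlt; case: eqP ij => // /val_inj ->; rewrite ltnn.
have -> : shuffle_exp (fun i => b (s i)) (fun i => w (s i)) = (C + Y)%N.
  rewrite -big_split; apply: eq_bigr => i _ /=.
  rewrite (bigID (fun j : 'I_n => (s i < s j)%N)) /=; congr (_ + _)%N.
  apply: eq_bigl => j; apply: andb_id2l => ij.
  by rewrite -leqNgt leq_eqVlt eq_sym neq.
by rewrite !oddD; case: (odd X); case: (odd Y); case: (odd C); case: (odd _); case: (odd _).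
Qed.

(** * Total degree and homogeneous elements *)

Lemma tparD u v : tpar (u + v) = tpar u (+) tpar v.
Proof.
rewrite /tpar -oddD -(addrACA u.1 _ _ _).
by move: (u.1 + u.2) (v.1 + v.2) => x y; lia.
Qed.

Lemma tpar_sum (I : finType) (P : pred I) (v : I -> bideg) :
  tpar (\sum_(i | P i) v i) = odd (\sum_(i | P i) tpar (v i)).
Proof.
elim/big_ind2: _ => // [u k u' k' uk uk'|i _]; last by rewrite oddb.
by rewrite tparD oddD uk uk'.
Qed.

Section Graded.
Variables (K : comPzRingType) (X : gmod K).

Lemma homog_gproj u (x : X) : homog u (gproj u x).
Proof. by rewrite /homog gproj_proj eqxx. Qed.

Lemma gproj_ext (x y : X) : (forall u, gproj u x = gproj u y) -> x = y.
Proof.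
move=> xy; apply/eqP; rewrite -subr_eq0; apply/eqP.
have [s /andP[_ /eqP->]] := gproj_fin (x - y).
by apply: big1 => u _; rewrite linearB /= xy subrr.
Qed.

Lemma homog0 u : homog u (0 : X).
Proof. exact: linear0. Qed.

Lemma homogZ u c (x : X) : homog u x -> homog u (c *: x).
Proof. by move=> hx; rewrite /homog linearZ /= hx. Qed.

Lemma homog_sum u (I : Type) (s : seq I) (P : pred I) (F : I -> X) :
  (forall i, P i -> homog u (F i)) -> homog u (\sum_(i <- s | P i) F i).
Proof. by move=> hF; rewrite /homog linear_sum; apply: eq_bigr. Qed.

(** The chosen support in the definition of [ktwist] disappears after projection; linearity,
    invisible in the definition, follows from this. *)
Lemma gproj_ktwist u m (x : X) :
  gproj u (ktwist m x) = (-1) ^+ (m * tpar u) *: gproj u x.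
Proof.
have /andP[_ /eqP xE] := xchooseP (gproj_fin x).
rewrite -/(gsupp x) in xE; rewrite [in RHS]xE /ktwist !linear_sum.
apply: eq_bigr => v _; rewrite linearZ /= gproj_proj.
by case: eqP => [->|] //; rewrite !scaler0.
Qed.

Lemma ktwist_linear m : linear (@ktwist K X m).
Proof.
move=> c x y; apply: gproj_ext => u.
rewrite linearP /= !gproj_ktwist linearP /= scalerDr !scalerA.
by rewrite mulrC.
Qed.

Lemma homog_ktwist m u (x : X) : homog u x -> homog u (ktwist m x).
Proof. by move=> hx; rewrite (ktwist_homog m hx); apply: homogZ. Qed.

Lemma multilin_homog_ext n (W : lmodType K) (F G : ('I_n -> X) -> W) :
    @multilinear K _ (fun=> X) W F -> @multilinear K _ (fun=> X) W G ->
    (forall a w, (forall i, homog (w i) (a i)) -> F a = G a) ->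
  forall a, F a = G a.
Proof.
move=> Flin Glin FG a.
apply: (multilin_ext (P := fun _ (x : X) => exists w, homog w x) Flin Glin).
  move=> i; have [s /andP[_ /eqP xE]] := gproj_fin (a i).
  exists [seq gproj u (a i) | u <- s]; rewrite big_map; split=> // x.
  by case/mapP => u _ ->; exists u; apply: homog_gproj.
by move=> b /fin_all_exists[w]; apply: FG.
Qed.

Lemma lin_homog_ext (W : lmodType K) (f g : X -> W) :
    linear f -> linear g -> (forall w x, homog w x -> f x = g x) ->
  forall x, f x = g x.
Proof.
move=> flin glin fg x; have [s /andP[_ /eqP->]] := gproj_fin x.
rewrite (lin_sum flin) (lin_sum glin); apply: eq_bigr => u _.
exact/fg/homog_gproj.
Qed.

End Graded.
Lemma ktwist0 (K : comPzRingType) (X : gmod K) (x : X) : ktwist 0 x = x.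
Proof.
by apply: gproj_ext => u; rewrite gproj_ktwist mul0n expr0 scale1r.
Qed.

(** * Degrees of products of eps, and powers of dh *)

Definition epsdeg (k : nat) : bideg := (- k%:Z, 0).

Lemma epsdeg0 : epsdeg 0 = 0. Proof. by []. Qed.

Lemma epsdegD k l : epsdeg (k + l) = epsdeg k + epsdeg l.
Proof. by congr pair; rewrite -?opprD // addr0. Qed.

Lemma tpar_epsdeg k : tpar (epsdeg k) = odd k.
Proof. by rewrite /tpar /= addr0 abszN. Qed.

Lemma tparB_epsdeg u k : tpar (u - epsdeg k) = tpar u (+) odd k.
Proof. by rewrite -[in RHS](subrK (epsdeg k) u) [in RHS]tparD tpar_epsdeg addbK. Qed.

Lemma od_homog (K : comPzRingType) (O : operad_data K) n u (x : derived O n) b :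
  homog u x -> homog (u - epsdeg (edeg b)) ((x : OD O n) b).
Proof.
move=> hx; rewrite -hx ffunE.
have -> : (u.1 + (edeg b)%:Z, u.2) = u - epsdeg (edeg b).
  by case: u {hx} => p q; congr pair; rewrite /= ?opprK // subr0.
exact: homog_gproj.
Qed.

Section DhPower.
Variables (K : comPzRingType) (A : gcomplex K) (dh : A -> A).
Hypothesis dhP : is_bicomplex dh.

Definition dpow (b : bool) (x : A) : A := if b then dh x else x.

Lemma dpow_linear b : linear (dpow b).
Proof. by case: b => //; apply: dh_linear. Qed.

Lemma dpow_homog (b : bool) u x : homog u x -> homog (u + epsdeg b) (dpow b x).
Proof.
case: b => [/(dh_homog dhP)|]; last by rewrite addr0.
by congr homog; case: u => p q; congr pair; rewrite addr0.
Qed.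

Lemma dpow_dpow b c x :
  dpow b (dpow c x) = if b && c then 0 else dpow (b || c) x.
Proof. by case: b c => [] [] //=; rewrite (dh_dh dhP). Qed.

Lemma dv_dpow (b : bool) x : dv (dpow b x) = (-1) ^+ b *: dpow b (dv x).
Proof.
case: b; last by rewrite scale1r.
by apply/eqP; rewrite scaleN1r -addr_eq0 addrC (dh_dv dhP).
Qed.

End DhPower.

(** * Coefficients of the distributive law *)

Section Phi.
Variables (K : comPzRingType) (O : operad_data K).

Lemma od_pure_eq n (mu : O n) b : od_pure mu b b = mu.
Proof. by rewrite ffunE eqxx. Qed.

Lemma od_pure_neq n (mu : O n) b c : c != b -> od_pure mu b c = 0.
Proof. by rewrite ffunE => /negPf->. Qed.

Lemma edeg0 n : edeg (ebasis0 n) = 0%N.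
Proof. by apply: big1 => i _; rewrite ffunE. Qed.

Lemma edeg1 n (i : 'I_n) : edeg (ebasis1 i) = 1%N.
Proof.
rewrite /edeg (bigD1 i) //= big1 ?addn0 => [|j ji]; rewrite ffunE ?eqxx //.
by rewrite (negPf ji).
Qed.

(** The distributive law moves eps without changing their number. This disposes of the terms of the
    associativity law to which [assoc_parity] does not apply. *)
Lemma phi_edeg n (b : bool) (mu : O n) h : edeg h != b -> phi b mu h = 0.
Proof.
case: b => /= hb.
  rewrite sum_ffunE big1 // => i _; rewrite od_pure_neq //.
  by apply: contra hb => /eqP->; rewrite edeg1.
by rewrite od_pure_neq //; apply: contra hb => /eqP->; rewrite edeg0.
Qed.

Lemma phi_homog n b (mu : O n) h u : homog u mu -> homog u (phi b mu h).
Proof.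
move=> hmu; have hpure nu c : homog u nu -> homog u (od_pure nu c h : O n).
  by move=> hnu; rewrite ffunE; case: ifP => // _; apply: homog0.
case: b => /=; last exact: hpure.
by rewrite sum_ffunE; apply: homog_sum => i _; apply/hpure/homog_ktwist.
Qed.

End Phi.

(** * The sign identity behind associativity *)

Section Assoc.
Variables (r : nat) (m : 'I_r -> nat) (n : nat) (e : n = (\sum_(i < r) m i)%N).

(** The exponent that [od_gamma] passes to [ktwist] on the i-th inner operation. *)
Let c (al : ebasis r) (f h : ebasis n) (i : 'I_r) :=
  (\sum_(j < r | (j < i)%N) edeg (eblock e f j) + \sum_(j < r | (i < j)%N) al j +
   \sum_(j < r | (j < i)%N) edeg (eblock e h j))%N.

(* The left side collects the signs of od_gamma followed by the action on the
   composite, the right side those of acting by the y_i and then by x. *)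
Lemma assoc_parity (al : ebasis r) (f h : ebasis n) (v : 'I_r -> bideg)
    (w : 'I_n -> bideg) :
    (forall i, edeg (eblock e h i) = al i) ->
  let nu i := tpar (v i - epsdeg (edeg (eblock e f i))) in
  odd (shuffle_exp (fun p => h p) (fun p => f p) +
       shuffle_exp (fun p => h p + f p)%N (fun p => tpar (w p)) +
       \sum_i c al f h i * nu i +
       shuffle_exp (fun i => nu i) (fun i => \sum_(j < m i)
         tpar (w (bidx e j) + epsdeg (f (bidx e j)) + epsdeg (h (bidx e j)))%R)%N)%N =
  odd (shuffle_exp (fun i => tpar (v i)) (fun i => \sum_(j < m i) tpar (w (bidx e j)))%N +
       shuffle_exp (fun i => al i) (fun i => tpar (v i + \sum_(j < m i) w (bidx e j))%R) +
       \sum_i (shuffle_exp (fun j => eblock e f i j) (fun j => tpar (w (bidx e j))) +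
               shuffle_exp (fun j => eblock e h i j)
                 (fun j => tpar (w (bidx e j) + epsdeg (f (bidx e j)))%R)))%N.
Proof.
move=> hal nu.
(* In block i, [N] is the parity of the inner operation of O, [F] and [H] count the eps of [f] and
   [h], and [W] adds the parities of the inputs. All exponents between blocks are shuffles of these
   four. *)
pose N i : nat := nu i; pose F i := edeg (eblock e f i).
pose H i := edeg (eblock e h i).
pose W i := (\sum_(j < m i) tpar (w (bidx e j)))%N.
have tv i : tpar (v i) = odd (N i + F i)%N.
  by rewrite oddD oddb /nu tparB_epsdeg addbK.
have Fi i : (\sum_(j < m i) f (bidx e j) = F i)%N.
  by apply: eq_bigr => j _; rewrite eblockE.
have Hi i : (\sum_(j < m i) h (bidx e j) = H i)%N.
  by apply: eq_bigr => j _; rewrite eblockE.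
(* The three summands of [c] are three shuffles; the one in [al] is expressed through [H] by
   [hal]. *)
have -> : (\sum_i c al f h i * nu i = shuffle_exp N F + shuffle_exp H N + shuffle_exp N H)%N.
  rewrite [X in (X + _ + _)%N]shuffle_expE' shuffle_expE [X in (_ + X)%N]shuffle_expE'.
  rewrite -!big_split; apply: eq_bigr => i _ /=; rewrite /c !mulnDl.
  do 2?congr (_ + _)%N; rewrite mulnC //; congr (_ * _)%N.
  by apply: eq_bigr => j _; rewrite /H hal.
rewrite !oddD.
have -> : odd (shuffle_exp (fun i => nu i) (fun i => \sum_(j < m i)
    tpar (w (bidx e j) + epsdeg (f (bidx e j)) + epsdeg (h (bidx e j)))%R)%N) =
    odd (shuffle_exp N (fun i => W i + F i + H i)%N).
  apply: odd_shuffle => // i; rewrite -Fi -Hi -!big_split; apply: odd_sum => j _.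
  by rewrite !tparD !tpar_epsdeg !oddD !oddb.
have -> : odd (shuffle_exp (fun i => tpar (v i)) (fun i => \sum_(j < m i) tpar (w (bidx e j)))%N)
    = odd (shuffle_exp (fun i => N i + F i)%N W).
  by apply: odd_shuffle => // i; rewrite tv oddb.
have -> : odd (shuffle_exp (fun i => al i) (fun i => tpar (v i + \sum_(j < m i) w (bidx e j))%R))
    = odd (shuffle_exp H (fun i => N i + F i + W i)%N).
  apply: odd_shuffle => i; first by rewrite /H hal.
  by rewrite oddb tparD tv tpar_sum -oddD.
have -> : odd (\sum_i (shuffle_exp (fun j => eblock e f i j) (fun j => tpar (w (bidx e j))) +
               shuffle_exp (fun j => eblock e h i j)
                 (fun j => tpar (w (bidx e j) + epsdeg (f (bidx e j)))%R)))%N =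
  odd (\sum_i (shuffle_exp (fun j => f (bidx e (i := i) j)) (fun j => tpar (w (bidx e j)))) +
       \sum_i (shuffle_exp (fun j => h (bidx e (i := i) j)) (fun j => tpar (w (bidx e j)))) +
       \sum_i (shuffle_exp (fun j => h (bidx e (i := i) j)) (fun j => f (bidx e (i := i) j))))%N.
  rewrite -!big_split; apply: odd_sum => i _ /=; rewrite -addnA -shuffle_expDr !oddD.
  congr (_ (+) _); apply: odd_shuffle => j; rewrite ?eblockE //.
  by rewrite oddD tparD tpar_epsdeg !oddb.
rewrite (shuffle_exp_block e (fun p => h p)) (shuffle_exp_block e).
have shE (x x' y y' : 'I_r -> nat) : x =1 x' -> y =1 y' ->
    shuffle_exp x y = shuffle_exp x' y'.
  by move=> xx yy; rewrite (fext xx) (fext yy).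
rewrite (shE _ H _ F Hi Fi) (shE (fun i => \sum_(j < m i) (h (bidx e j) + f (bidx e j)))%N
  (fun i => H i + F i)%N _ W _ (frefl _)); last first.
  by move=> i; rewrite big_split /= Hi Fi.
have -> : (\sum_i shuffle_exp (fun j => h (bidx e (i := i) j) + f (bidx e j))
             (fun j => tpar (w (bidx e j))) =
  \sum_i (shuffle_exp (fun j => h (bidx e (i := i) j)) (fun j => tpar (w (bidx e j)))) +
  \sum_i (shuffle_exp (fun j => f (bidx e (i := i) j)) (fun j => tpar (w (bidx e j)))))%N.
  by rewrite -big_split; apply: eq_bigr => i _; rewrite shuffle_expDl.
rewrite !shuffle_expDl !shuffle_expDr !oddD.
(* Ten parities remain: three inside blocks and seven between blocks. The shuffles of [N] with [F]
   and of [N] with [H] occur twice on the left; the other eight occur once on each side. *)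
do 2!move: (odd _) (odd _) (odd _) (odd _) (odd _).
by do 10!case.
Qed.

End Assoc.

(** For a single eps the Koszul sign is that of a differential passing the inputs before i, as in
    [act_chain]. *)
Lemma shuffle_exp_ebasis1 n (i : 'I_n) (y : 'I_n -> nat) :
  shuffle_exp (fun j => ebasis1 i j) y = (\sum_(j < n | (j < i)%N) y j)%N.
Proof.
rewrite shuffle_expE' (bigD1 i) //= ffunE eqxx mul1n.
by rewrite [X in (_ + X)%N]big1 ?addn0 // => j ji; rewrite ffunE (negPf ji).
Qed.

Lemma dpow_ebasis1 (K : comPzRingType) (A : gcomplex K) (dh : A -> A) n (i : 'I_n)
    (a : 'I_n -> A) :
  (fun j => dpow dh (ebasis1 i j) (a j)) =
  @dfwith _ (fun=> Defs.gsort A) a i (dh (a i)).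
Proof.
apply: fext => j; rewrite ffunE.
by case: dfwithP => [|k ik]; rewrite ?eqxx // eq_sym (negPf ik).
Qed.

Lemma eblock_neq r (m : 'I_r -> nat) n (e : n = (\sum_(i < r) m i)%N)
    (f g : ebasis n) : f != g -> exists i, eblock e f i != eblock e g i.
Proof.
move=> fg; apply/existsP; rewrite -negb_forall; apply: contra fg => /forallP fg.
by rewrite -(eblockK e f) -(eblockK e g); apply/eqP; congr ejoin; apply: fext => i; apply/eqP.
Qed.

Lemma eblock0 r (m : 'I_r -> nat) n (e : n = (\sum_(i < r) m i)%N) i :
  eblock e (ebasis0 n) i = ebasis0 (m i).
Proof. by apply/ffunP => j; rewrite !ffunE. Qed.

Lemma eblock_ord1 n (e : n = (\sum_(i < 1) n)%N) (b : ebasis n) i :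
  eblock (m := fun=> n) e b i = b.
Proof. by apply/ffunP => j; rewrite ffunE bidx_ord1. Qed.

Lemma edeg_eblock1 n (e : n = (\sum_(i < n) 1)%N) (b : ebasis n) i :
  edeg (eblock (m := fun=> 1%N) e b i) = b i.
Proof. by rewrite /edeg big_ord1 ffunE bidx_const1. Qed.

Lemma dfwith_ord1 (T : Type) (a : 'I_1 -> T) x :
  @dfwith _ (fun=> T) a (ord0 : 'I_1) x = fun=> x.
Proof. by apply: fext => i; rewrite (ord1 i) dfwith_in. Qed.

(** * Composition in the derived operad *)

Section Gamma.
Variables (K : comPzRingType) (O : graded_operad K).

Lemma gamma_multilinear r (m : 'I_r -> nat) n (e : n = (\sum_(i < r) m i)%N) (mu : O r) :
  @multilinear K _ (fun i => O (m i)) (O n) (fun nu => op_gamma O e mu nu).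
Proof. by move=> nu i; apply: (op_gamma_linearr (go_operad O)). Qed.

Lemma gamma_ktwist r (m : 'I_r -> nat) n (e : n = (\sum_(i < r) m i)%N)
    (mu : O r) (c : 'I_r -> nat) (nu : forall i, O (m i)) v :
    (forall i, homog (v i) (nu i)) ->
  op_gamma O e mu (fun i => ktwist (c i) (nu i)) =
  (-1) ^+ (\sum_i c i * tpar (v i))%N *: op_gamma O e mu nu.
Proof.
move=> hnu; rewrite expr_sum -(multilinZ _ _ (gamma_multilinear e mu)).
by congr op_gamma; apply: fext => i; apply: ktwist_homog.
Qed.

Lemma od_pure0 n b : od_pure (0 : O n) b = 0.
Proof. by apply/ffunP => c; rewrite !ffunE if_same. Qed.

Lemma od_pure_sum n (x : OD O n) : x = \sum_b od_pure (x b) b.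
Proof.
apply/ffunP => b; rewrite sum_ffunE (bigD1 b) //= od_pure_eq big1 ?addr0 // => c cb.
by rewrite od_pure_neq // eq_sym.
Qed.

Lemma od_pure_linear n b : linear (fun mu : O n => od_pure mu b).
Proof.
move=> c x y; apply/ffunP => b'; rewrite !ffunE.
by case: ifP => // _; rewrite scaler0 addr0.
Qed.

Lemma od_pure_homog n (mu : O n) b u :
  homog u mu -> homog (u + epsdeg (edeg b)) (od_pure mu b : derived O n).
Proof.
move=> hmu; apply/ffunP => c; rewrite !ffunE; case: eqP => [->|_]; last exact: linear0.
rewrite (_ : (_, _) = u) //; case: (u) => p q.
by rewrite /= subrK addr0.
Qed.

Lemma od_mul0 n (h f : ebasis n) : od_mul (0 : O n) h f = 0.
Proof. by rewrite /od_mul od_pure0 if_same. Qed.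

Lemma od_mul_0l n (mu : O n) (f : ebasis n) : od_mul mu (ebasis0 n) f = od_pure mu f.
Proof.
rewrite /od_mul ifF; last by apply/existsP => -[p]; rewrite ffunE.
by congr od_pure; apply/ffunP => p; rewrite !ffunE.
Qed.

Lemma od_mul_0r n (mu : O n) (h : ebasis n) : od_mul mu h (ebasis0 n) = od_pure mu h.
Proof.
rewrite /od_mul ifF; last by apply/existsP => -[p]; rewrite [ebasis0 _ _]ffunE andbF.
by congr od_pure; apply/ffunP => p; rewrite !ffunE orbF.
Qed.

Let gamma_linear r (m : 'I_r -> nat) n (e : n = (\sum_(i < r) m i)%N)
  (nu : forall i, O (m i)) : linear (fun mu => op_gamma O e mu nu).
Proof. exact: op_gamma_linearl (go_operad O) r m n e nu. Qed.

Lemma ktwist_zero (X : gmod K) k : ktwist k (0 : X) = 0.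
Proof. exact: lin0 (@ktwist_linear K X k). Qed.

Lemma phi0 n b (h : ebasis n) : phi b (0 : O n) h = 0.
Proof.
case: b => /=; last by rewrite od_pure0 ffunE.
by rewrite sum_ffunE big1 // => i _; rewrite ktwist_zero od_pure0 ffunE.
Qed.

(** On pure elements the sums over the exponents of the arguments collapse; only the sum over the
    terms produced by [phi] survives. *)
Lemma gamma_pure r (m : 'I_r -> nat) n (e : n = (\sum_(i < r) m i)%N) (mu : O r)
    (al : ebasis r) (nu : forall i, O (m i)) (f : ebasis n) :
  op_gamma (derived O) e (od_pure mu al) (fun i => od_pure (nu i) (eblock e f i)) =
  \sum_h (-1) ^+ shuffle_exp (fun p => (h : ebasis n) p : nat) (fun p => f p : nat)
    *: od_mul (op_gamma O e mu (fun i => ktwist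
          (\sum_(j < r | (j < i)%N) edeg (eblock e f j) + \sum_(j < r | (i < j)%N) al j
           + \sum_(j < r | (j < i)%N) edeg (eblock e h j))%N
          (phi (al i) (nu i) (eblock e h i)))) h f.
Proof.
rewrite /= /od_gamma (bigD1 al) //= [X in _ + X]big1 ?addr0 => [|al' ne]; last first.
  rewrite big1 // => f' _; rewrite big1 // => h _.
  by rewrite (od_pure_neq _ ne) (lin0 (gamma_linear _ _)) od_mul0 scaler0.
rewrite (bigD1 f) //= [X in _ + X]big1 ?addr0 => [|f' /(eblock_neq e)[i ne]]; last first.
  rewrite big1 // => h _; rewrite (multilin0 (i := i) (gamma_multilinear e _)).
    by rewrite od_mul0 scaler0.
  by rewrite (od_pure_neq _ ne) phi0 ktwist_zero.
apply: eq_bigr => h _; congr (_ *: od_mul _ _ _); rewrite od_pure_eq.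
by congr op_gamma; apply: fext => i; rewrite od_pure_eq.
Qed.

Lemma gamma_incl_pure r (m : 'I_r -> nat) n (e : n = (\sum_(i < r) m i)%N) (mu : O r)
    (nu : forall i, O (m i)) (f : ebasis n) :
  op_gamma (derived O) e (derived_incl mu) (fun i => od_pure (nu i) (eblock e f i)) =
  od_pure (op_gamma O e mu
    (fun i => ktwist (\sum_(j < r | (j < i)%N) edeg (eblock e f j))%N (nu i))) f.
Proof.
rewrite gamma_pure (bigD1 (ebasis0 n)) //=.
rewrite [X in _ + X]big1 ?addr0 => [|h /(eblock_neq e)[i ne]]; last first.
  rewrite (multilin0 (i := i) (gamma_multilinear e _)) ?od_mul0 ?scaler0 //.
  by rewrite ffunE /= od_pure_neq ?ktwist_zero // -(eblock0 e).
rewrite shuffle_exp0l => [|p]; last by rewrite ffunE.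
rewrite scale1r od_mul_0l; congr od_pure; congr op_gamma; apply: fext => i.
rewrite ffunE /= eblock0 od_pure_eq; congr ktwist.
rewrite [X in (_ + X + _)%N]big1 => [|j _]; last by rewrite ffunE.
by rewrite [X in (_ + X)%N]big1 ?addn0 // => j _; rewrite eblock0 edeg0.
Qed.

Lemma gamma_incl r (m : 'I_r -> nat) n (e : n = (\sum_(i < r) m i)%N) (mu : O r)
    (nu : forall i, O (m i)) :
  op_gamma (derived O) e (derived_incl mu) (fun i => derived_incl (nu i)) =
  derived_incl (op_gamma O e mu nu).
Proof.
have := gamma_incl_pure e mu nu (ebasis0 n); set x := fun i => _; set y := fun i => _.
have -> : x = fun i => derived_incl (nu i) by apply: fext => i; rewrite /x eblock0.
move=> ->; congr od_pure; congr op_gamma; apply: fext => i.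
by rewrite /y big1 ?ktwist0 // => j _; rewrite eblock0 edeg0.
Qed.

(** This factorization is the source of uniqueness. No sign appears, because what passes the eps are
    units, of degree 0. *)
Lemma gamma_incl_eps n (e : n = (\sum_(i < n) 1)%N) (mu : O n) (b : ebasis n) :
  op_gamma (derived O) e (derived_incl mu)
    (fun i => od_pure (op_unit O) (eblock (m := fun=> 1%N) e b i)) = od_pure mu b.
Proof.
rewrite gamma_incl_pure (_ : (fun i => _) = fun=> op_unit O).
  by rewrite (op_gamma_unitr (go_operad O)).
apply: fext => i; rewrite (ktwist_homog _ (op_unit_homog (go_operad O))).
by rewrite muln0 scale1r.
Qed.

(** The distributive law as a relation in the derived operad; letting both sides act gives the
    Leibniz rule for dh. *)
Lemma gamma_eps_incl n (e : n = (\sum_(i < 1) n)%N) (mu : O n) :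
  op_gamma (derived O) e (derived_eps O) (fun=> derived_incl mu) =
  \sum_(i < n) od_pure (ktwist 1 mu) (ebasis1 i).
Proof.
rewrite [RHS]od_pure_sum; have := gamma_pure e (op_unit O) (ebasis1 ord0) (fun=> mu) (ebasis0 n).
set x := fun i : 'I_1 => od_pure _ _.
have -> : x = fun=> derived_incl mu by apply: fext => i; rewrite /x eblock0.
move=> ->; apply: eq_bigr => h _.
rewrite shuffle_exp0r => [|p]; last by rewrite ffunE.
rewrite scale1r od_mul_0r; congr od_pure.
rewrite (_ : (fun i => _) = fun=> phi true mu h).
  by rewrite (op_gamma_unitl (go_operad O)).
apply: fext => i; rewrite eblock_ord1 (ord1 i) [ebasis1 _ _]ffunE eqxx.
rewrite -[RHS]ktwist0; congr ktwist.
by rewrite !big_pred0 // => j; rewrite (ord1 j).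
Qed.

Lemma gamma_eps_eps (e : 1%N = (\sum_(i < 1) 1)%N) :
  op_gamma (derived O) e (derived_eps O) (fun=> derived_eps O) = 0.
Proof.
have := gamma_pure e (op_unit O) (ebasis1 ord0) (fun=> op_unit O) (ebasis1 ord0).
set x := fun i : 'I_1 => od_pure _ _.
have -> : x = fun=> derived_eps O by apply: fext => i; rewrite /x eblock_ord1.
move=> ->; apply: big1 => h _.
(* Either the eps produced by [phi] meets the inner one at the only input, or [h] is empty while
   [phi] must produce one eps. *)
have [h1|h0] := boolP (h ord0).
  rewrite /od_mul ifT ?scaler0 //; apply/existsP; exists ord0.
  by rewrite h1 ffunE eqxx.
rewrite (multilin0 (i := ord0) (gamma_multilinear e _)) ?od_mul0 ?scaler0 //.
rewrite phi_edeg ?ktwist_zero // eblock_ord1 ffunE eqxx.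
by rewrite /edeg big_ord1 (negPf h0).
Qed.

End Gamma.

(** * From a bicomplex algebra to an action of the derived operad *)

Section Extension.
Variables (K : comPzRingType) (O : graded_operad K) (A : gcomplex K).
Variables (dh : A -> A) (beta : op_action O A).
Hypotheses (dhP : is_bicomplex dh) (betaP : is_bicomplex_algebra dh beta).

Let bA : is_algebra beta. Proof. by case: betaP. Qed.

(* The sign moves the eps^(b_j) past the inputs on their left. *)
Definition ext_action : op_action (derived O) A := fun n x a =>
  \sum_(b : ebasis n) beta ((x : OD O n) b)
     (fun i => dpow dh (b i) (ktwist (\sum_(j < n | (i < j)%N) b j) (a i))).

Let beta_multilinear n (mu : O n) :
  @multilinear K _ (fun=> A) A (fun a => beta mu a).
Proof. by move=> a i; apply: (alg_linearr bA). Qed.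

Let beta_linear n (a : 'I_n -> A) : linear (fun mu => beta mu a).
Proof. exact: alg_linearl bA n a. Qed.

Let beta_dfwithZ n (mu : O n) a i c (x : A) :
  beta mu (@dfwith _ (fun=> Defs.gsort A) a i (c *: x)) =
  c *: beta mu (@dfwith _ (fun=> Defs.gsort A) a i x).
Proof. exact: (linZ (alg_linearr bA mu a i)). Qed.

Let dhL b : linear (dpow dh b) := dpow_linear dhP b.

Lemma ext_action_homog n (x : derived O n) (a : 'I_n -> A) w :
    (forall i, homog (w i) (a i)) ->
  ext_action x a =
  \sum_(b : ebasis n) (-1) ^+ shuffle_exp (fun i => b i) (fun i => tpar (w i))
     *: beta ((x : OD O n) b) (fun i => dpow dh (b i) (a i)).
Proof.
move=> aw; apply: eq_bigr => b _.
rewrite shuffle_expE expr_sum -(multilinZ _ _ (@beta_multilinear _ _)).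
congr beta; apply: fext => i; rewrite (ktwist_homog _ (aw i)).
by rewrite (linZ (dpow_linear dhP _)) mulnC.
Qed.

Lemma ext_action_pure n (mu : O n) b (a : 'I_n -> A) :
  ext_action (od_pure mu b : derived O n) a =
  beta mu (fun i => dpow dh (b i) (ktwist (\sum_(j < n | (i < j)%N) b j) (a i))).
Proof.
rewrite /ext_action (bigD1 b) //= big1 ?addr0 => [|c cb]; rewrite ffunE.
  by rewrite eqxx.
by rewrite (negPf cb) (lin0 (@beta_linear _ _)).
Qed.

Lemma ext_action_linearl n (a : 'I_n -> A) :
  linear (fun x : derived O n => ext_action x a).
Proof.
move=> c x y; rewrite scaler_sumr -big_split; apply: eq_bigr => b _ /=.
by rewrite !ffunE (@beta_linear _ _).
Qed.

Lemma ext_action_linearr n (x : derived O n) :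
  @multilinear K _ (fun=> A) A (fun a => ext_action x a).
Proof.
apply: multilinear_sum => b.
apply: (multilinear_comp (V := fun=> A) (L := fun i x => dpow dh (b i) (ktwist _ x))) => //.
by move=> i c y z; rewrite (ktwist_linear _ c) (dpow_linear dhP _ c).
Qed.

Lemma ext_action_deg n (x : derived O n) (a : 'I_n -> A) u v :
  homog u x -> (forall i, homog (v i) (a i)) ->
  homog (u + \sum_(i < n) v i) (ext_action x a).
Proof.
move=> ux va; apply: homog_sum => b _.
have := alg_homog bA (od_homog b ux)
          (fun i => dpow_homog dhP (b i) (homog_ktwist (\sum_(j < n | (i < j)%N) b j)%N (va i))).
rewrite big_split /= -(big_morph _ epsdegD epsdeg0) addrACA [X in _ + X]addrC.
by rewrite subrr addr0.
Qed.

Lemma ext_action_unit (a : 'I_1 -> A) : ext_action (op_unit (derived O)) a = a ord0.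
Proof.
rewrite ext_action_pure -[RHS](alg_unit bA); congr beta; apply: fext => i.
by rewrite ffunE big1 ?ktwist0 // => j _; rewrite ffunE.
Qed.

Lemma eps_ext_action a : eps_action ext_action a = dh a.
Proof.
rewrite /eps_action ext_action_pure (alg_unit bA) ffunE eqxx big_pred0 ?ktwist0 //.
by move=> j; rewrite (ord1 j).
Qed.

Lemma restr_ext_action n (mu : O n) (a : 'I_n -> A) :
  restr_action ext_action mu a = beta mu a.
Proof.
rewrite /restr_action ext_action_pure; congr beta; apply: fext => i.
by rewrite ffunE big1 ?ktwist0 // => j _; rewrite ffunE.
Qed.

(** For [b = true] this is the Leibniz rule: the summand with dh on the i-th input sits at
    [h = ebasis1 i], and the [ktwist 1] in [phi] supplies the sign of passing [mu]. *)
Lemma dpow_beta n (mu : O n) (z : 'I_n -> A) u v (b : bool) :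
  homog u mu -> (forall i, homog (v i) (z i)) ->
  dpow dh b (beta mu z) =
  \sum_h (-1) ^+ shuffle_exp (fun i => (h : ebasis n) i) (fun i => tpar (v i))
    *: beta (phi b mu h) (fun i => dpow dh (h i) (z i)).
Proof.
move=> hmu hz; case: b => /=; last first.
  rewrite (bigD1 (ebasis0 n)) //= od_pure_eq big1 ?addr0 => [|h h0]; last first.
    by rewrite od_pure_neq // (lin0 (beta_linear _)) scaler0.
  rewrite shuffle_exp0l => [|i]; last by rewrite ffunE.
  by rewrite scale1r; congr beta; apply: fext => i; rewrite ffunE.
have [_ /(_ n mu z u v hmu hz) -> _] := betaP.
rewrite (lin0 (beta_linear _)) add0r.
(* After exchanging the sums, each i meets only [h = ebasis1 i]. *)
transitivity (\sum_h \sum_(i < n)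
    (-1) ^+ shuffle_exp (fun i => (h : ebasis n) i) (fun i => tpar (v i))
    *: beta (od_pure (ktwist 1 mu) (ebasis1 i) h) (fun i => dpow dh (h i) (z i))).
  rewrite exchange_big; apply: eq_bigr => i _ /=.
  rewrite (bigD1 (ebasis1 i)) //= od_pure_eq [X in _ = _ + X]big1 ?addr0 => [|h h1]; last first.
    by rewrite od_pure_neq // (lin0 (beta_linear _)) scaler0.
  rewrite (ktwist_homog _ hmu) (linZ (beta_linear _)) scalerA -exprD addnC mul1n.
  by rewrite shuffle_exp_ebasis1 dpow_ebasis1.
apply: eq_bigr => h _; rewrite -scaler_sumr sum_ffunE.
by rewrite (lin_sum (beta_linear _)).
Qed.

Lemma ext_action_chain :
  act_chain ext_action (fun n => @dv K (derived O n)) (@dv K A).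
Proof.
move=> n x a u v xu av /=.
rewrite (lin0 (ext_action_linearl a)) add0r.
rewrite (ext_action_homog x av).
rewrite (lin_sum (@dv_linear _ A)).
have [_ _ dvP] := betaP.
(* Sign of the term with [dv] on input i: the sign of the action, then [dv] passing the coefficient
   of [x], the arguments before i, and the possible dh in slot i, with which it anticommutes. *)
pose s (b : ebasis n) (i : 'I_n) := ((shuffle_exp (fun i => b i) (fun i => tpar (v i)) +
  (tpar (u - epsdeg (edeg b))%R +
   \sum_(j < n | (j < i)%N) tpar (v j + epsdeg (b j))%R) + b i)%N).
pose t b (i : 'I_n) := beta ((x : OD O n) b)
  (fun j => dpow dh (b j) (@dfwith _ (fun=> Defs.gsort A) a i (dv (a i)) j)).
transitivity (\sum_b \sum_i (-1) ^+ s b i *: t b i).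
  apply: eq_bigr => b _; rewrite (linZ (@dv_linear _ A)).
  rewrite (dvP _ _ _ _ _ (od_homog b xu) (fun i => dpow_homog dhP (b i) (av i))).
  rewrite go_dv (lin0 (beta_linear _)) add0r scaler_sumr.
  apply: eq_bigr => i _; rewrite (dv_dpow dhP).
  rewrite beta_dfwithZ !scalerA -!exprD; congr (_ *: _); congr beta.
  by rewrite (dfwith_map (fun j => dpow dh (b j)) a (dv (a i))).
rewrite exchange_big; apply: eq_bigr => i _ /=.
(* [dv] flips the parity of input i alone, so the sign of the action on the new inputs changes by
   the number of eps to the right of i. *)
pose w := @dfwith _ (fun=> bideg) v i ((v i).1, (v i).2 - 1).
have aw j : homog (w j) (@dfwith _ (fun=> Defs.gsort A) a i (dv (a i)) j).
  rewrite /w; case: dfwithP => [|k ik]; first by rewrite dfwith_in; apply: dv_homog.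
  by rewrite dfwith_out.
rewrite (ext_action_homog x aw) scaler_sumr; apply: eq_bigr => b _.
rewrite scalerA -exprD; congr (_ *: _); apply: sign_parity.
rewrite [in RHS]oddD.
have -> : odd (shuffle_exp (fun j => b j) (fun j => tpar (w j))) =
    odd (shuffle_exp (fun j => b j) (fun j => tpar (v j) + (j == i))%N).
  apply: odd_shuffle => // j; rewrite /w; case: dfwithP => [|k ik].
    rewrite eqxx oddD addbT oddb /tpar /= addrA.
    by move: ((v i).1 + (v i).2) => y; lia.
  by rewrite eq_sym (negPf ik) addn0.
rewrite -[in RHS]oddD [in RHS]shuffle_expDr [X in _ = odd (_ + (_ + X))%N]shuffle_expE.
rewrite [X in _ = odd (_ + (_ + X))%N](bigD1 i) //= eqxx mul1n.
rewrite [X in _ = odd (_ + (_ + (_ + X)))%N]big1 => [|j /negPf->//].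
have -> : odd (s b i) = odd (shuffle_exp (fun i => b i) (fun i => tpar (v i)) +
  (tpar u + edeg b + (\sum_(j < n | (j < i)%N) tpar (v j) +
     \sum_(j < n | (j < i)%N) b j)) + b i)%N.
  rewrite /s !oddD !oddb tparB_epsdeg; do 3!congr (_ (+) _).
  rewrite -oddD -big_split; apply: odd_sum => j _.
  by rewrite oddD !oddb tparD tpar_epsdeg oddb.
(* The eps before i and in slot i are counted twice on the left and cancel; those after i match the
   right side. *)
rewrite /edeg (sum_ltn_gtn i) !oddD addbF !oddb.
move: (odd _) (odd _) (odd _) (odd _) (tpar u) (b i).
by do 6!case.
Qed.

Lemma ext_action_equivariant n (s : 'S_n) (x : derived O n) (a : 'I_n -> A) w :
    (forall p, homog (w p) (a p)) ->
  ext_action (op_act (derived O) s x) a =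
  (-1) ^+ perm_exp s (fun p => tpar (w p))
    *: ext_action x (fun p => a (s p)).
Proof.
move=> aw; rewrite (ext_action_homog _ aw).
rewrite (ext_action_homog x (fun p => aw (s p))) scaler_sumr.
pose sh (b : ebasis n) : ebasis n := [ffun i => b (s i)].
have sh_bij : bijective sh.
  exists (fun b : ebasis n => [ffun i => b (s^-1%g i)]) => b; apply/ffunP => i.
    by rewrite !ffunE permKV.
  by rewrite !ffunE permK.
rewrite [RHS](reindex sh) /=; last exact: onW_bij.
apply: eq_bigr => b _; rewrite ffunE (linZ (beta_linear _)).
rewrite (alg_equivariant bA _ _ (fun i => dpow_homog dhP (b i) (aw i))).
rewrite !scalerA -!exprD; congr (_ *: _); last congr beta; last first.
  by apply: fext => i; rewrite ffunE.
apply: sign_parity.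
have := perm_exp_shuffle s (fun i => b i) (fun i => tpar (w i)).
rewrite !oddD.
have -> : odd (shuffle_exp (fun i => sh b i) (fun i => tpar (w (s i)))) =
          odd (shuffle_exp (fun i => b (s i)) (fun i => tpar (w (s i)))).
  by apply: odd_shuffle => // i; rewrite ffunE.
have -> : odd (perm_exp s (fun i => tpar (w i + epsdeg (b i)))) =
          odd (perm_exp s (fun i => tpar (w i) + b i)%N).
  by apply: odd_perm_exp => i; rewrite oddD tparD tpar_epsdeg !oddb.
move: (odd _) (odd _) (odd _) (odd _) (odd _).
by do 5!case.
Qed.

(** If two eps collide, the right side vanishes by dh^2 = 0; otherwise [h p + f p] is the exponent
    [h p || f p]. One formula thus covers both cases of [od_mul]. *)
Lemma ext_action_mul n (mu : O n) (h f : ebasis n) (a : 'I_n -> A) w :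
    (forall p, homog (w p) (a p)) ->
  ext_action (od_mul mu h f : derived O n) a =
  (-1) ^+ shuffle_exp (fun p => h p + f p)%N (fun p => tpar (w p))
    *: beta mu (fun p => dpow dh (h p) (dpow dh (f p) (a p))).
Proof.
move=> aw; rewrite /od_mul; case: ifP => [/existsP[p /andP[hp fp]]|/negbT].
  rewrite (lin0 (ext_action_linearl a)).
  rewrite (multilin0 (i := p) (beta_multilinear mu)) ?scaler0 //.
  by rewrite (dpow_dpow dhP) hp fp.
rewrite negb_exists => /forallP hf.
have hfp p : h p && f p = false by apply/negbTE/hf.
rewrite (ext_action_homog _ aw) (bigD1 [ffun p => h p || f p]) //=.
rewrite od_pure_eq big1 ?addr0 => [|b hb]; last first.
  by rewrite od_pure_neq // (lin0 (beta_linear _)) scaler0.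
congr (_ *: _); last first.
  by congr beta; apply: fext => p; rewrite ffunE (dpow_dpow dhP) hfp.
apply: sign_parity; apply: odd_shuffle => // p.
by rewrite ffunE; move: (hfp p); case: (h p); case: (f p).
Qed.


Lemma ext_action_assoc r (m : 'I_r -> nat) n (e : n = (\sum_(i < r) m i)%N)
    (x : derived O r) (y : forall i, derived O (m i)) (a : 'I_n -> A) v w :
    (forall i, homog (v i) (y i)) -> (forall p, homog (w p) (a p)) ->
  ext_action (op_gamma (derived O) e x y) a =
  (-1) ^+ shuffle_exp (fun i => tpar (v i))
            (fun i => \sum_(j < m i) tpar (w (bidx e j)))%N
    *: ext_action x
         (fun i => ext_action (y i) (fun j => a (bidx e j))).
Proof.
move=> hy ha.
pose nu (al : ebasis r) (f h : ebasis n) i : O (m i) :=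
  phi (al i) ((y i : OD O (m i)) (eblock e f i)) (eblock e h i).
pose a' (f h : ebasis n) p := dpow dh (h p) (dpow dh (f p) (a p)).
pose G al f h := beta ((x : OD O r) al)
  (fun i => beta (nu al f h i) (fun j => a' f h (bidx e j))).
have nu_homog al f h i : homog (v i - epsdeg (edeg (eblock e f i))) (nu al f h i).
  by apply: phi_homog; apply: od_homog.
have a'_homog (f h : ebasis n) p : homog (w p + epsdeg (f p) + epsdeg (h p)) (a' f h p).
  by do 2!apply: dpow_homog => //.
pose EL (al : ebasis r) (f h : ebasis n) := (shuffle_exp (fun p => h p) (fun p => f p) +
  shuffle_exp (fun p => h p + f p)%N (fun p => tpar (w p)) +
  \sum_(i < r) (\sum_(j < r | (j < i)%N) edeg (eblock e f j) +
    \sum_(j < r | (i < j)%N) al j + \sum_(j < r | (j < i)%N) edeg (eblock e h j)) *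
      tpar (v i - epsdeg (edeg (eblock e f i)))%R +
  shuffle_exp (fun i => tpar (v i - epsdeg (edeg (eblock e f i)))%R)
    (fun i => \sum_(j < m i)
      tpar (w (bidx e j) + epsdeg (f (bidx e j)) + epsdeg (h (bidx e j)))%R)%N)%N.
pose ER (al : ebasis r) (f h : ebasis n) :=
  (shuffle_exp (fun i => tpar (v i)) (fun i => \sum_(j < m i) tpar (w (bidx e j)))%N +
   shuffle_exp (fun i => al i) (fun i => tpar (v i + \sum_(j < m i) w (bidx e j))%R) +
   \sum_i (shuffle_exp (fun j => eblock e f i j) (fun j => tpar (w (bidx e j))) +
           shuffle_exp (fun j => eblock e h i j)
                 (fun j => tpar (w (bidx e j) + epsdeg (f (bidx e j)))%R)))%N.
(* Left side: the composite acts term by term, and associativity and linearity of [beta] collect the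
   exponent [EL]. *)
transitivity (\sum_al \sum_f \sum_h (-1) ^+ EL al f h *: G al f h).
  rewrite (lin_sum (ext_action_linearl a)); apply: eq_bigr => al _.
  rewrite (lin_sum (ext_action_linearl a)); apply: eq_bigr => f _.
  rewrite (lin_sum (ext_action_linearl a)); apply: eq_bigr => h _.
  rewrite (linZ (ext_action_linearl a)) (ext_action_mul _ _ _ ha) scalerA -exprD.
  rewrite (gamma_ktwist e _ _ (nu_homog al f h)) (linZ (beta_linear _)) scalerA -exprD.
  rewrite (alg_assoc bA e _ (nu_homog al f h) (a'_homog f h)) scalerA -exprD.
  by [].
transitivity (\sum_al \sum_f \sum_h (-1) ^+ ER al f h *: G al f h).
  apply: eq_bigr => al _; apply: eq_bigr => f _; apply: eq_bigr => h _.
  (* Where [hal] fails, [phi] has coefficient 0 and the exponents need not agree. *)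
  have [/forallP hal|] := boolP [forall i, edeg (eblock e h i) == al i].
    congr (_ *: _); apply: sign_parity; apply: assoc_parity => i.
    exact/eqP.
  rewrite negb_forall => /existsP[i hi].
  rewrite /G (multilin0 (i := i) (beta_multilinear _)) ?scaler0 //.
  by rewrite /nu phi_edeg // (lin0 (beta_linear _)).
have Z_homog i : homog (v i + \sum_(j < m i) w (bidx e j))
    (ext_action (y i) (fun j => a (bidx e j))).
  by apply: ext_action_deg.
rewrite (ext_action_homog x Z_homog) scaler_sumr; apply: eq_bigr => al _.
pose z i f h := (-1) ^+ (shuffle_exp (fun j => (f : ebasis (m i)) j) (fun j => tpar (w (bidx e j))) +
           shuffle_exp (fun j => (h : ebasis (m i)) j)
                 (fun j => tpar (w (bidx e j) + epsdeg (f j))%R))%N *: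
  beta (phi (al i) ((y i : OD O (m i)) f) h)
    (fun j => dpow dh (h j) (dpow dh (f j) (a (bidx e j)))).
have -> : (fun i => dpow dh (al i) (ext_action (y i) (fun j => a (bidx e j)))) =
    fun i => \sum_f \sum_h z i f h.
  apply: fext => i; rewrite (ext_action_homog _ (fun j => ha (bidx e j))).
  rewrite (lin_sum (dhL _)); apply: eq_bigr => f _.
  rewrite (linZ (dhL _)) (dpow_beta (al i) (od_homog f (hy i))
     (fun j => dpow_homog dhP (f j) (ha (bidx e j)))).
  by rewrite scaler_sumr; apply: eq_bigr => h _; rewrite scalerA -exprD.
(* Slot i carries its own sums over the exponents of block i; they are merged into sums over all n
   inputs, first for [f], then for [h]. *)
rewrite (multilin_distr _ (eblockK e) (ejoinK e) (beta_multilinear _)).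
rewrite !scaler_sumr; apply: eq_bigr => f _.
rewrite (multilin_distr _ (eblockK e) (ejoinK e) (beta_multilinear _)).
rewrite !scaler_sumr; apply: eq_bigr => h _.
rewrite /z (multilinZ _ _ (beta_multilinear _)) !scalerA -expr_sum -!exprD.
congr (_ *: _).
  congr (_ ^+ (_ + _)); apply: eq_bigr => i _; congr (_ + shuffle_exp _ _)%N.
  by apply: fext => j; rewrite eblockE.
congr beta; apply: fext => i; congr beta; apply: fext => j.
by rewrite !eblockE.
Qed.

Lemma ext_action_algebra : is_gc_algebra ext_action.
Proof.
split; last exact: ext_action_chain.
split.
- exact: ext_action_linearl.
- exact: ext_action_linearr.
- exact: ext_action_deg.
- exact: ext_action_unit.
- exact: ext_action_assoc.
- exact: ext_action_equivariant.
Qed.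

End Extension.

(** * From an action of the derived operad to a bicomplex algebra *)

Section Restriction.
Variables (K : comPzRingType) (O : graded_operad K) (A : gcomplex K).
Variable act : op_action (derived O) A.
Hypothesis actP : is_gc_algebra act.

Let actA : is_algebra act. Proof. by case: actP. Qed.
Let dh := eps_action act.

Let act_linear n (a : 'I_n -> A) : linear (fun x : derived O n => act x a).
Proof. exact: alg_linearl actA n a. Qed.

Lemma eps_homog : homog (epsdeg 1) (derived_eps O).
Proof.
have := od_pure_homog (ebasis1 ord0) (op_unit_homog (go_operad O)).
by rewrite edeg1 add0r.
Qed.

Lemma incl_homog n (mu : O n) u : homog u mu -> homog u (derived_incl mu).
Proof. by move=> /(od_pure_homog (ebasis0 n)); rewrite edeg0 addr0. Qed.

Lemma eps_action_linear : linear dh.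
Proof.
move=> c x y; have := alg_linearr actA (derived_eps O) (fun=> 0) ord0 c x y.
by rewrite !dfwith_ord1.
Qed.

(** Associativity applied to [gamma_incl_eps]: the inner operations are the eps^(b_i), of parity
    [b i], so the shuffle sign is the one displayed. *)
Lemma act_pure n (mu : O n) (b : ebasis n) (a : 'I_n -> A) w :
    (forall i, homog (w i) (a i)) ->
  act (od_pure mu b : derived O n) a =
  (-1) ^+ shuffle_exp (fun i => b i : nat) (fun i => tpar (w i) : nat)
    *: restr_action act mu (fun i => dpow dh (b i) (a i)).
Proof.
move=> aw; have e : n = (\sum_(i < n) 1)%N by rewrite sum_nat_const card_ord muln1.
have hb i : homog (epsdeg (b i))
    (od_pure (op_unit O) (eblock (m := fun=> 1%N) e b i) : derived O 1).
  have := od_pure_homog (eblock (m := fun=> 1%N) e b i) (op_unit_homog (go_operad O)).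
  by rewrite edeg_eblock1 add0r.
rewrite -{1}(gamma_incl_eps e) (alg_assoc actA e _ hb aw); congr (_ *: _).
  apply/sign_parity/odd_shuffle => i; first by rewrite tpar_epsdeg !oddb.
  by rewrite big_ord1 bidx_const1.
congr act; apply: fext => i.
have -> : (fun j : 'I_1 => a (bidx (m := fun=> 1%N) e (i := i) j)) = fun=> a i.
  by apply: fext => j; rewrite bidx_const1.
have bE : eblock (m := fun=> 1%N) e b i = [ffun=> b i].
  by apply/ffunP => j; rewrite !ffunE bidx_const1.
rewrite bE; case: (b i) => /=.
  by rewrite /dh /eps_action; congr act; congr od_pure; apply/ffunP => j; rewrite !ffunE (ord1 j).
exact: (alg_unit actA (fun=> a i)).
Qed.

Lemma eps_bicomplex : is_bicomplex dh.
Proof.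
split; first exact: eps_action_linear.
- move=> u x hx; have := alg_homog actA eps_homog (fun _ : 'I_1 => hx).
  rewrite big_ord1 (_ : (u.1 - 1, u.2) = epsdeg 1 + u) //.
  by case: u {hx} => p q; congr pair; rewrite ?add0r // addrC.
(* Associativity is available on homogeneous inputs only, so linearity comes first; [gamma_eps_eps]
   then gives the claim. *)
- have lin : linear (fun x => dh (dh x)).
    by move=> c x y; rewrite !eps_action_linear.
  apply: (lin_homog_ext lin (g := fun=> 0)) => [c x y|w x hx].
    by rewrite scaler0 addr0.
  have e : 1%N = (\sum_(i < 1) 1)%N by rewrite big_ord1.
  have := alg_assoc actA e (derived_eps O) (fun=> eps_homog) (fun _ : 'I_1 => hx).
  rewrite gamma_eps_eps (lin0 (act_linear _)) shuffle_exp1 scale1r => H.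
  by rewrite /dh /eps_action -H.
- apply: (lin_homog_ext (g := fun=> 0)) => [c x y|c x y|w x hx].
  + rewrite (dv_linear c) !eps_action_linear (dv_linear c) scalerDr.
    by rewrite addrACA.
  + by rewrite scaler0 addr0.
  (* The chain condition for eps itself: its differential is 0 and its degree is odd, hence the
     anticommutation. *)
  have [_ /(_ _ (derived_eps O) _ _ _ eps_homog (fun _ : 'I_1 => hx)) H] := actP.
  rewrite /dh /eps_action H (lin0 (act_linear _)) add0r big_ord1 big_pred0_eq addn0.
  rewrite expr1 scaleN1r addrC -/(eps_action _ _).
  by rewrite dfwith_ord1 addNr.
Qed.

Lemma restr_algebra : is_algebra (restr_action act).
Proof.
split.
- move=> n a c mu nu; rewrite /restr_action /derived_incl.
  by rewrite (od_pure_linear (ebasis0 n)) (act_linear a).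
- by move=> n mu a i; apply: (alg_linearr actA).
- by move=> n mu a u v hmu ha; apply: (alg_homog actA) => //; apply: incl_homog.
- exact: alg_unit actA.
- move=> r m n e mu nu a v w hnu ha; rewrite /restr_action -(gamma_incl e).
  exact: (alg_assoc actA e _ (fun i => incl_homog (hnu i)) ha).
- move=> n s mu a w ha; rewrite /restr_action -(alg_equivariant actA _ _ ha).
  congr act; apply/ffunP => b; rewrite !ffunE.
  (* A permutation fixes the empty exponent and costs no sign there, so [derived_incl] is
     equivariant. *)
  have -> : ([ffun i => b (s i)] == ebasis0 n) = (b == ebasis0 n).
    apply/eqP/eqP => [/ffunP bs|->]; apply/ffunP => i; last by rewrite !ffunE.
    by have := bs (s^-1%g i); rewrite !ffunE permKV.
  case: eqP => [->|_].
    rewrite (_ : perm_exp _ _ = 0%N) ?scale1r //.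
    by do 2!(apply: big1 => ? _); rewrite ffunE.
  by rewrite (lin0 (op_act_linear (go_operad O) s)) scaler0.
Qed.

(** The composite of eps with [mu] acts in two ways: by associativity as dh after [mu], and by
    [gamma_eps_incl] with [act_pure] as the sum of the terms with dh on one input. *)
Lemma restr_bicomplex_algebra : is_bicomplex_algebra dh (restr_action act).
Proof.
have [_ chainP] := actP; have rlin n a := alg_linearl restr_algebra n a.
split; first exact: restr_algebra.
- move=> n mu a u v hmu ha; rewrite (lin0 (rlin _ _)) add0r.
  have e : n = (\sum_(i < 1) n)%N by rewrite big_ord1.
  have := alg_assoc actA e (derived_eps O) (fun=> incl_homog hmu) ha.
  rewrite shuffle_exp1 scale1r.
  have -> : (fun i : 'I_1 => act (derived_incl mu)
               (fun j => a (bidx (m := fun=> n) e (i := i) j))) =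
            fun=> restr_action act mu a.
    by apply: fext => i; congr act; apply: fext => j; rewrite bidx_ord1.
  rewrite -/(eps_action act _) -/dh => <-.
  rewrite gamma_eps_incl (lin_sum (act_linear a)); apply: eq_bigr => i _.
  rewrite (act_pure _ _ ha) dpow_ebasis1 shuffle_exp_ebasis1 (ktwist_homog _ hmu).
  by rewrite (linZ (rlin _ _)) scalerA -exprD mul1n addnC.
- move=> n mu a u v hmu ha; rewrite go_dv (lin0 (rlin _ _)) /restr_action.
  by rewrite (chainP _ _ _ _ _ (incl_homog hmu) ha) (lin0 (act_linear a)).
Qed.

(** Uniqueness: [act_pure] determines the action on homogeneous inputs, and both sides are
    multilinear. *)
Lemma act_ext_action n (x : derived O n) (a : 'I_n -> A) :
  act x a = ext_action dh (restr_action act) x a.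
Proof.
apply: multilin_homog_ext a => [a i|a i|a w aw].
- exact: alg_linearr actA n x a i.
- exact: (ext_action_linearr eps_bicomplex restr_bicomplex_algebra).
rewrite (ext_action_homog eps_bicomplex restr_bicomplex_algebra _ aw).
rewrite [in LHS](od_pure_sum x) (lin_sum (act_linear a)).
by apply: eq_bigr => b _; apply: act_pure.
Qed.

End Restriction.

(* The assignment act |-> (action of eps, restriction to O) is a bijection from
   DO-algebra structures on A to pairs (horizontal differential, O-algebra
   structure on the resulting bicomplex). *)
Theorem proposition3p7 (K : comPzRingType) (O : graded_operad K)
    (A : gcomplex K) :
  (forall act : op_action (derived O) A,
     is_gc_algebra act ->
     is_bicomplex (eps_action act) /\
     is_bicomplex_algebra (eps_action act) (restr_action act)) /\
  (forall (dh : A -> A) (beta : op_action O A),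
     is_bicomplex dh -> is_bicomplex_algebra dh beta ->
     exists! act : op_action (derived O) A,
       [/\ is_gc_algebra act,
           (forall a : A, eps_action act a = dh a)
         & (forall (n : nat) (mu : O n) (a : 'I_n -> A),
              restr_action act mu a = beta n mu a)]).
Proof.
split=> [act actP|dh beta dhP betaP].
  by split; [apply: eps_bicomplex | apply: restr_bicomplex_algebra].
exists (ext_action dh beta); split=> [|act [actP eps_dh restr_beta]].
  split; first exact: ext_action_algebra.
  - exact: eps_ext_action.
  - exact: restr_ext_action.
(* Replacing the given data by those recovered from [act] turns uniqueness into [act_ext_action]. *)
have -> : dh = eps_action act by apply: fext => a; rewrite eps_dh.
have -> : beta = restr_action act.
  by apply: fext => n; apply: fext => mu; apply: fext => a; rewrite restr_beta.
apply: fext => n; apply: fext => x; apply: fext => a.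
symmetry; exact: act_ext_action.
Qed.
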